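(* Let $\vec p=(p_1,1)$ with $1<p_1<\infty$, and let $\vec a,\vec b,\vec c\in\mathbb{R}^2$, $\vec\alpha\in(-1,\infty)^2$. Then the following are equivalent: (1) $S_{\vec a,\vec b,\vec c}$ is bounded from $L^{\vec p}_{\vec\alpha}(T_B\times T_B)$ to $L^\infty(T_B\times T_B)$; (2) $T_{\vec a,\vec b,\vec c}$ is bounded from $L^{\vec p}_{\vec\alpha}(T_B\times T_B)$ to $L^\infty(T_B\times T_B)$; (3) $a_1>0$, $a_2\ge0$, $p_1(b_1+1)>\alpha_1+1$, $b_2\ge\alpha_2$, $c_1=n+1+a_1+b_1-\frac{n+1+\alpha_1}{p_1}$, and $c_2=a_2+b_2-\alpha_2$.
   Context: Let $n$ be a positive integer. For $z=(z_1,\dots,z_n)\in\mathbb{C}^n$ write $z=x+iy$ with $x,y\in\mathbb{R}^n$, $z'=(z_1,\dots,z_{n-1})$, $y'=(y_1,\dots,y_{n-1})$. Let $B=\{y\in\mathbb{R}^n: |y'|^2<y_n\}$ and $T_B=\{x+iy: x\in\mathbb{R}^n, y\in B\}$. For $z\in T_B$ put $\rho(z)=y_n-|y'|^2>0$, and for $z,u\in T_B$ put $\rho(z,u)=\frac14\big(\sum_{j=1}^{n-1}(z_j-\overline{u_j})^2-2i(z_n-\overline{u_n})\big)$; this has positive real part, and complex powers $\rho(z,u)^c$ are taken with the principal branch. $dV$ is Lebesgue measure on $\mathbb{C}^n$ and $dV_\alpha(z)=\rho(z)^\alpha dV(z)$. For $\vec p=(p_1,p_2)\in[1,\infty]^2$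 and $\vec\alpha=(\alpha_1,\alpha_2)$, $L^{\vec p}_{\vec\alpha}(T_B\times T_B)$ is the space of measurable $f$ on $T_B\times T_B$ with finite mixed norm $\|f\|_{\vec p,\vec\alpha}=\big\{\int_{T_B}\big(\int_{T_B}|f(z,w)|^{p_1}dV_{\alpha_1}(z)\big)^{p_2/p_1}dV_{\alpha_2}(w)\big\}^{1/p_2}$, with the inner (resp. outer) integral replaced by an essential supremum in $z$ (resp. $w$) when $p_1=\infty$ (resp. $p_2=\infty$); when $\vec p=(\infty,\infty)$ this is $L^\infty(T_B\times T_B)$. For $\vec a=(a_1,a_2),\vec b=(b_1,b_2),\vec c=(c_1,c_2)\in\mathbb{R}^2$, $T_{\vec a,\vec b,\vec c}f(z,w)=\rho(z)^{a_1}\rho(w)^{a_2}\int_{T_B}\int_{T_B}\frac{\rho(u)^{b_1}\rho(\eta)^{b_2}}{\rho(z,u)^{c_1}\rho(w,\eta)^{c_2}}f(u,\eta)\,dV(u)\,dV(\eta)$ and $S_{\vec a,\vec b,\vec c}f(z,w)=\rho(z)^{a_1}\rho(w)^{a_2}\int_{T_B}\int_{T_B}\frac{\rho(u)^{b_1}\rho(\eta)^{b_2}}{|\rho(z,u)|^{c_1}|\rho(w,\eta)|^{c_2}}f(u,\eta)\,dV(u)\,dV(\eta)$. An operator is bounded from $X$ to $Y$ if for every $f\in X$ the defining integral converges for a.e. $(z,w)$ and $\|Tf\|_Y\le C\|f\|_X$ with $C$ independent of $f$. *)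

(* Defs.v *)
From HB Require Import structures.
From mathcomp Require Import all_boot all_order all_algebra.
From mathcomp Require Import all_classical all_reals all_analysis.
From mathcomp Require Import complex.
Set Implicit Arguments.
Unset Strict Implicit.
Unset Printing Implicit Defensive.
Import Order.TTheory GRing.Theory Num.Theory.
Import numFieldNormedType.Exports.
Local Open Scope classical_set_scope.
Local Open Scope ring_scope.

(** * Product of two sigma-finite measures, packaged as a sigma-finite measure.
    (The library proves sigma-finiteness of [m1 \x m2] but its canonical
    instance is shadowed; we re-package it under an alias.) *)
Section pmeas.
Local Open Scope ereal_scope.
Context (R : realType) d1 d2 (T1 : measurableType d1) (T2 : measurableType d2).
Variable m1 : {sigma_finite_measure set T1 -> \bar R}.
Variable m2 : {sigma_finite_measure set T2 -> \bar R}.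
Definition pmeas : set (T1 * T2)%type -> \bar R := (m1 \x m2).
HB.instance Definition _ := Measure.on pmeas.
Lemma pmeas_sigma_finite : sigma_finite setT pmeas.
Proof.
have /sigma_finiteP[F [TF ndF Foo]] := sigma_finiteT m1.
have /sigma_finiteP[G [TG ndG Goo]] := sigma_finiteT m2.
exists (fun n => F n `*` G n).
 rewrite -setXTT TF TG predeqE => -[x y]; split.
    move=> [/= [n _ Fnx] [k _ Gky]]; exists (maxn n k) => //; split.
    - by move: x Fnx; exact/subsetPset/ndF/leq_maxl.
    - by move: y Gky; exact/subsetPset/ndG/leq_maxr.
  by move=> [n _ []/= ? ?]; split; exists n.
move=> k; have [? ?] := Foo k; have [? ?] := Goo k.
split; first exact: measurableX.
by rewrite /pmeas product_measure1E// lte_mul_pinfty// ge0_fin_numE.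
Qed.
HB.instance Definition _ := Measure_isSigmaFinite.Build _ _ _ pmeas
  pmeas_sigma_finite.
End pmeas.

(** * Euclidean space R^m with its Borel sigma-algebra and Lebesgue measure,
    built as the iterated product R * (R * ( ... * unit)). *)
Fixpoint rsp (R : realType) (m : nat) : {d : measure_display & measurableType d} :=
  match m with
  | 0 => existT (fun d => measurableType d) _ (unit : measurableType _)
  | m'.+1 => existT (fun d => measurableType d) _
      ((measurableTypeR R) * projT2 (rsp R m') : measurableType _)%type
  end.

Definition Rsp (R : realType) (m : nat) : measurableType (projT1 (rsp R m)) :=
  projT2 (rsp R m).

Fixpoint lebn (R : realType) (m : nat) : {sigma_finite_measure set (Rsp R m) -> \bar R} :=
  match m return {sigma_finite_measure set (Rsp R m) -> \bar R} with
  | 0 => (dirac tt : {sigma_finite_measure set unit -> \bar R})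
  | m'.+1 => (@pmeas R _ _ _ _ (@lebesgue_measure R) (lebn R m')
               : {sigma_finite_measure set _ -> \bar R})
  end.

Fixpoint coord (R : realType) (m : nat) : Rsp R m -> nat -> R :=
  match m return Rsp R m -> nat -> R with
  | 0 => fun _ _ => 0
  | m'.+1 => fun p k => match k with
                       | 0 => p.1
                       | k'.+1 => coord p.2 k'
                       end
  end.

(** * C^n, identified with R^(2n): the complex coordinate z_(j+1)
    (j = 0, ..., n-1) is  x_(j+1) + i y_(j+1)  with  x_(j+1) = real coordinate 2j,
    y_(j+1) = real coordinate 2j+1.  [dV] is Lebesgue measure on R^(2n). *)
Definition Cn (R : realType) (n : nat) := Rsp R (2 * n).
Definition dV (R : realType) (n : nat) := lebn R (2 * n).

Section tube.
Variables (R : realType) (n : nat).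
Local Open Scope complex_scope.

Definition xc (z : Cn R n) (j : nat) : R := coord z (2 * j).
Definition yc (z : Cn R n) (j : nat) : R := coord z (2 * j + 1).
Definition zc (z : Cn R n) (j : nat) : R[i] := Complex (xc z j) (yc z j).

Definition cconj (w : R[i]) : R[i] := Complex (complex.Re w) (- complex.Im w).
Definition cabs (w : R[i]) : R := Num.sqrt (complex.Re w ^+ 2 + complex.Im w ^+ 2).

(** principal branch of w^c (c real) for complex.Re w > 0, where Arg w = atan (complex.Im w / complex.Re w) *)
Definition cpow (w : R[i]) (c : R) : R[i] :=
  let t := c * atan (complex.Im w / complex.Re w) in
  Complex ((cabs w `^ c) * cos t) ((cabs w `^ c) * sin t).

Definition inB (z : Cn R n) : Prop :=
  \sum_(j < n.-1) (yc z j) ^+ 2 < yc z n.-1.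
Definition TB : set (Cn R n) := [set z | inB z].

Definition rho (z : Cn R n) : R := yc z n.-1 - \sum_(j < n.-1) (yc z j) ^+ 2.

Definition rho2 (z u : Cn R n) : R[i] :=
  (4%:R)^-1%:C * (\sum_(j < n.-1) (zc z j - cconj (zc u j)) ^+ 2
                 - 2%:R%:C * Complex 0 1 * (zc z n.-1 - cconj (zc u n.-1))).

Definition dV2 := pmeas (dV R n) (dV R n).

Definition mixnorm (p1 p2 al1 al2 : R) (f : (Cn R n * Cn R n)%type -> R[i]) : \bar R :=
  ((\int[dV R n]_(w in TB)
     (((\int[dV R n]_(z in TB) ((cabs (f (z, w)) `^ p1) * (rho z `^ al1))%:E)
         `^ (p2 / p1)) * (rho w `^ al2)%:E)) `^ (p2^-1))%E.

Definition inLmixed (p1 p2 al1 al2 : R) (f : (Cn R n * Cn R n)%type -> R[i]) : Prop :=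
  measurable_fun (TB `*` TB) (fun q => complex.Re (f q)) /\
  measurable_fun (TB `*` TB) (fun q => complex.Im (f q)) /\
  (mixnorm p1 p2 al1 al2 f < +oo)%E.

Definition iconv (K : (Cn R n * Cn R n)%type -> (Cn R n * Cn R n)%type -> R[i])
    (f : (Cn R n * Cn R n)%type -> R[i]) (zw : (Cn R n * Cn R n)%type) : Prop :=
  dV2.-integrable (TB `*` TB) (fun q => (complex.Re (K zw q * f q))%:E) /\
  dV2.-integrable (TB `*` TB) (fun q => (complex.Im (K zw q * f q))%:E).

Definition iop (P : (Cn R n * Cn R n)%type -> R[i])
    (K : (Cn R n * Cn R n)%type -> (Cn R n * Cn R n)%type -> R[i])
    (f : (Cn R n * Cn R n)%type -> R[i]) (zw : (Cn R n * Cn R n)%type) : R[i] :=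
  P zw * Complex (Rintegral dV2 (TB `*` TB) (fun q => complex.Re (K zw q * f q)))
          (Rintegral dV2 (TB `*` TB) (fun q => complex.Im (K zw q * f q))).

Definition pref (a1 a2 : R) (zw : (Cn R n * Cn R n)%type) : R[i] :=
  ((rho zw.1 `^ a1) * (rho zw.2 `^ a2))%:C.

Definition kerT (b1 b2 c1 c2 : R) (zw ue : (Cn R n * Cn R n)%type) : R[i] :=
  ((rho ue.1 `^ b1) * (rho ue.2 `^ b2))%:C /
  (cpow (rho2 zw.1 ue.1) c1 * cpow (rho2 zw.2 ue.2) c2).

Definition kerS (b1 b2 c1 c2 : R) (zw ue : (Cn R n * Cn R n)%type) : R[i] :=
  (((rho ue.1 `^ b1) * (rho ue.2 `^ b2)) /
   ((cabs (rho2 zw.1 ue.1) `^ c1) * (cabs (rho2 zw.2 ue.2) `^ c2)))%:C.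

Definition bounded_to_Linfty (p1 p2 al1 al2 : R) (P : (Cn R n * Cn R n)%type -> R[i])
    (K : (Cn R n * Cn R n)%type -> (Cn R n * Cn R n)%type -> R[i]) : Prop :=
  exists C : R, forall f, inLmixed p1 p2 al1 al2 f ->
    {ae dV2, forall zw, (TB `*` TB) zw -> iconv K f zw} /\
    {ae dV2, forall zw, (TB `*` TB) zw ->
        cabs (iop P K f zw) <= C * fine (mixnorm p1 p2 al1 al2 f)}.

End tube.

Arguments pref {R} n a1 a2 zw.
Arguments kerT {R} n b1 b2 c1 c2 zw ue.
Arguments kerS {R} n b1 b2 c1 c2 zw ue.
Arguments bounded_to_Linfty {R} n p1 p2 al1 al2 P K.

(* Main.v *)
Require Import Defs.
From HB Require Import structures.
From mathcomp Require Import all_boot all_order all_algebra.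
From mathcomp Require Import all_classical all_reals all_analysis.
From mathcomp Require Import measurable_realfun.
From mathcomp Require Import complex ring lra.
Set Implicit Arguments.
Unset Strict Implicit.
Unset Printing Implicit Defensive.
Import Order.TTheory GRing.Theory Num.Theory.
Import numFieldNormedType.Exports.
Local Open Scope classical_set_scope.
Local Open Scope ring_scope.

Local Notation coord := Defs.coord.

(** Both kernels have modulus
    [rho(u)^b1 rho(eta)^b2 / (|rho(z,u)|^c1 |rho(w,eta)|^c2)], and [T] differs
    from [S] by a unimodular phase only.

    Sufficiency: Hoelder's inequality in [u] and a pointwise bound in [eta]
    reduce the claim to
    [int rho(u)^t |rho(z,u)|^(-s) dV(u) <= C rho(z)^(n+1+t-s)].  Since
    [4 |rho(z,u)|] dominates [rho(z)], [rho(u)], each [(u_i - z_i)^2], and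
    [|x_n - shift|] for a shift depending on the other coordinates, splitting
    the exponent [s] bounds the integrand by a product of functions of one
    variable, up to a measure preserving triangular change of variables.

    Necessity: on parabolic boxes [tbox s l], where [|u_j| <= kap s],
    [|x_n| <= kap s^2] and [l^2 <= rho < 4 l^2], with [kap] small, [rho(z,u)] is
    nearly real and comparable to [max(r,l)^2] for [z] in [tbox r r].  Hence the
    phase of [T] is harmless and testing on combinations of indicators of
    disjoint boxes gives an inequality between sums of powers.  One box forces
    the equalities and the weak inequalities; [N] boxes of equal norm would give
    [N <= C N^(1/p1)] if [a1 > 0] or [p1 (b1 + 1) > al1 + 1] failed. *)

(** * Integrals over [Rsp] *)

(** Strict and weak inequalities reflect the two exponents. In eta the exponent is 1, so the dual
    condition is a supremum and endpoint exponents survive. In u the dual norm is an integral, which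
    diverges at [a1 = 0] and at [p1 (b1 + 1) = al1 + 1], but only logarithmically: all dyadic scales
    contribute alike, no single box detects it, and this is why [N] boxes are compared with
    [N^(1/p1)]. The boxes have two independent parameters because the divergence sits in two places:
    [s = l = 2^k] tests the kernel at infinity (condition on [a1]), while [s = 1], [l = 2^(-k)]
    tests it at the boundary of the tube (condition on [b1]). Lebesgue measure is an iterated
    product, so the changes of variables have to be triangular. They are, because the real and
    imaginary parts of the n-th complex coordinate come last: both [rho u] and the imaginary part of
    [rho2 z u] are, up to sign and factor, one of these coordinates minus a function of earlier
    ones. *)

Lemma measurable_coord (R : realType) m k :
  measurable_fun [set: Rsp R m] (fun u : Rsp R m => coord u k).
Proof.
elim: m k => [|m IH] k /=; first exact: measurable_cst.
case: k => [|k]; first exact: measurable_fst.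
exact: (measurableT_comp (IH k) measurable_snd).
Qed.

Lemma measurable_subr (R : realType) (c : R) :
  measurable_fun [set: measurableTypeR R]
    (fun x : measurableTypeR R => (x - c : measurableTypeR R)).
Proof. by apply: measurable_funB => //; exact: measurable_cst. Qed.

Lemma lebesgue_measure_shift (R : realType) (c : R) (A : set R) :
  measurable A ->
  pushforward lebesgue_measure
    (fun x : measurableTypeR R => (x - c : measurableTypeR R)) A =
  lebesgue_measure A.
Proof.
move=> mA.
pose mf : {mfun measurableTypeR R >-> measurableTypeR R} :=
  mfun_Sub (mem_set (measurable_subr c)).
apply/esym.
apply: (@lebesgue_measure_unique R (pushforward lebesgue_measure mf)) => //.
move=> _ [[a b]] _ <- /=; rewrite /pushforward.
have -> : (fun x : R => x - c) @^-1` `]a, b] = `]a + c, b + c]%classic.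
  apply/seteqP; split => x /=; rewrite !in_itv /= => /andP[h1 h2].
  - by rewrite -ltrBrDr h1 -lerBlDr h2.
  - by rewrite ltrBrDr h1 lerBlDr h2.
rewrite !lebesgue_measure_itv /= !lte_fin ltrD2r -!EFinB.
by rewrite opprD addrACA subrr addr0.
Qed.

Lemma ge0_integral_shift (R : realType) (c : R) (f : R -> \bar R) :
  measurable_fun [set: R] f -> (forall x, 0 <= f x)%E ->
  (\int[lebesgue_measure]_x f (x - c)%R = \int[lebesgue_measure]_x f x)%E.
Proof.
move=> mf f0.
have := ge0_integral_pushforward (measurable_subr c) lebesgue_measure
  measurableT mf (fun x _ => f0 x).
rewrite preimage_setT => <-.
apply: eq_measure_integral => [|? A mA _]; first exact: measurable_subr.
exact: lebesgue_measure_shift.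
Qed.

Lemma emeasurable_prod d (T : measurableType d) (R : realType) (D : set T)
    (I : Type) (s : seq I) (h : I -> T -> \bar R) :
  (forall i, measurable_fun D (h i)) ->
  measurable_fun D (fun x => \prod_(i <- s) h i x)%E.
Proof.
move=> mh; elim: s => [|i s IH].
  by under eq_fun do rewrite big_nil; exact: measurable_cst.
by under eq_fun do rewrite big_cons; apply: emeasurable_funM.
Qed.

(* Triangular changes of variables [u_i |-> u_i - sig_i (u_0 .. u_(i-1))]
   preserve Lebesgue measure, so that they do not affect the integral of a
   product of functions of one variable. *)
Lemma integral_shear_prod (R : realType) m (phi : nat -> R -> \bar R)
    (sig : nat -> Rsp R m -> R) :
  (forall i, measurable_fun [set: R] (phi i)) ->
  (forall i x, 0 <= phi i x)%E ->
  (forall i, measurable_fun [set: Rsp R m] (sig i)) ->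
  (forall i u v, (forall j, (j < i)%N -> coord u j = coord v j) ->
     sig i u = sig i v) ->
  (\int[lebn R m]_u (\prod_(0 <= i < m) phi i (coord u i - sig i u)%R) =
   \prod_(0 <= i < m) \int[lebesgue_measure]_x phi i x)%E.
Proof.
elim: m phi sig => [|m IH] phi sig mphi phi0 msig dsig.
  under eq_integral do rewrite big_geq//.
  rewrite big_geq// integral_cst//= mul1e.
  by rewrite diracE in_setT.
have m1 i : measurable_fun [set: Rsp R m.+1]
    (fun u => phi i (coord u i - sig i u)).
  apply: (measurableT_comp (mphi i)).
  by apply: measurable_funB; [exact: measurable_coord|exact: msig].
rewrite big_nat_recl//=.
set F := (X in (\int[_]_u X u = _)%E).
have mF : measurable_fun [set: Rsp R m.+1] F.
  by apply: emeasurable_prod.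
have F0 u : (0 <= F u)%E by apply: prode_ge0.
transitivity (\int[lebesgue_measure]_x \int[lebn R m]_u F (x, u))%E.
  exact: (@fubini_tonelli1 _ _ _ _ _ lebesgue_measure (lebn R m) F mF F0).
(* No coordinate precedes index 0, so [sig 0] is constant and the first variable undergoes a plain
   translation. For fixed [x] the remaining shifts are again triangular in [u], and the induction
   hypothesis gives a value [P] free of [x]. *)
have [c hc] : exists c, forall u, sig 0%N u = c.
  by exists (sig 0%N point) => u; exact: dsig.
pose P := (\prod_(0 <= i < m) \int[lebesgue_measure]_x phi i.+1 x)%E.
have P0 : (0 <= P)%E by apply: prode_ge0 => i _; exact: integral_ge0.
have E x : (\int[lebn R m]_u F (x, u) = P * phi 0%N (x - c)%R)%E.
  under eq_integral => u _ do
    rewrite /F big_nat_recl// /= hc.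
  rewrite ge0_integralZl//; first last.
  - by move=> u _; apply: prode_ge0.
  - apply: emeasurable_prod => i.
    apply: (measurableT_comp (f := phi i.+1)) => //.
    apply: measurable_funB; first exact: measurable_coord.
    exact: (measurableT_comp (msig i.+1) (pair1_measurable x)).
  rewrite muleC; congr (_ * _)%E.
  apply: (IH (fun i => phi i.+1) (fun i u => sig i.+1 (x, u))) => //.
  - by move=> i; apply: (measurableT_comp (msig i.+1) (pair1_measurable x)).
  - by move=> i u v h; apply: dsig => -[|j] //= ji; apply: h.
under eq_integral do rewrite E.
rewrite ge0_integralZl//; last first.
  apply: (measurableT_comp (f := phi 0%N)) => //.
  exact: measurable_subr.
by rewrite (@ge0_integral_shift R c)// muleC.
Qed.

(** * One-dimensional power integrals *)

(** The fundamental theorem of calculus is applied on compact intervals of positive numbers only;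
    monotone exhaustion carries a uniform bound to an endpoint at 0 or at infinity. *)
Lemma ge0_integral_bigcup_le d (T : measurableType d) (R : realType)
    (mu : {measure set T -> \bar R}) (F : (set T)^nat) (f : T -> \bar R) M :
  nondecreasing_seq F -> (forall i, measurable (F i)) ->
  measurable_fun setT f -> (forall x, 0 <= f x)%E ->
  (forall i, \int[mu]_(x in F i) f x <= M)%E ->
  (\int[mu]_(x in \bigcup_i F i) f x <= M)%E.
Proof.
move=> ndF mF mf f0 FM.
have mfF i : measurable_fun (F i) f by exact: measurable_funTS.
have := @ge0_nondecreasing_set_cvg_integral _ _ _ F f mu ndF mF mfF (fun i x _ => f0 x).
by apply: cvge_le; apply: nearW.
Qed.

Lemma integral_powR_cc (R : realType) (e a b : R) :
  0 < a -> a < b -> e + 1 != 0 ->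
  (\int[lebesgue_measure]_(x in `[a, b]) (x `^ e)%:E =
   (b `^ (e + 1) / (e + 1) - a `^ (e + 1) / (e + 1))%:E)%E.
Proof.
move=> a0 ab e0.
have dF (x : R) : 0 < x -> is_derive x 1 (fun y : R => y `^ (e + 1) / (e + 1)) (x `^ e).
  move=> x0.
  have h : is_derive x 1 (fun y : R => y `^ (e + 1)) ((e + 1) * x `^ (e + 1 - 1)).
    exact: is_derive1_powR.
  have -> : (fun y : R => y `^ (e + 1) / (e + 1)) =
            (e + 1)^-1 \*: (fun y : R => y `^ (e + 1) : R).
    by apply/funext => y /=; rewrite mulrC.
  apply: is_derive_eq.
  by rewrite addrK /GRing.scale /= mulrA mulVf// mul1r.
have cF (x : R) : 0 < x -> {for x, continuous (fun y : R => y `^ (e + 1) / (e + 1))}.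
  move=> x0; apply/differentiable_continuous; rewrite -derivable1_diffP.
  by have [] := dF _ x0.
rewrite (@continuous_FTC2 R (fun y : R => y `^ e) (fun y : R => y `^ (e + 1) / (e + 1)) a b)//.
- apply: derivable_within_continuous => x; rewrite in_itv /= => /andP[ax _].
  by apply: derivable_powR; rewrite in_itv /= andbT (lt_le_trans a0).
- split.
  + move=> x; rewrite in_itv /= => /andP[ax _].
    by have [] := dF _ (lt_trans a0 ax).
  + by apply: cvg_at_right_filter; exact: cF.
  + by apply: cvg_at_left_filter; apply: cF; exact: lt_trans ab.
- move=> x; rewrite in_itv /= => /andP[ax _].
  by rewrite derive1E; have [_] := dF _ (lt_trans a0 ax).
Qed.

Lemma measurable_EFin_powR (R : realType) (e : R) :
  measurable_fun [set: measurableTypeR R] (fun x : R => (x `^ e)%:E).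
Proof. by apply/measurable_EFinP; exact: measurable_powR. Qed.

Lemma integral_powR_0c_le (R : realType) (t A : R) : -1 < t -> 0 < A ->
  (\int[lebesgue_measure]_(x in `[0%R, A]) (x `^ t)%:E <=
   (A `^ (t + 1) / (t + 1))%:E)%E.
Proof.
move=> t1 A0.
have t10 : 0 < t + 1 by lra.
rewrite -integral_itv_obnd_cbnd; last first.
  by apply: measurable_funTS; exact: measurable_EFin_powR.
(* The denominators start at 2, so every interval is nondegenerate, as [integral_powR_cc]
   demands. *)
have -> : `]0, A]%classic = \bigcup_i `[A / (i.+1%:R + 1), A]%classic.
  apply/seteqP; split => x /=; rewrite ?in_itv /=.
    move=> /andP[x0 xA]; exists (Num.truncn (A / x)) => //=.
    rewrite in_itv /= xA andbT ler_pdivrMr ?ltr_wpDl//.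
    rewrite mulrC -ler_pdivrMr//; apply: ltW.
    by apply: (lt_trans (truncnS_gt _)); rewrite ltrDl.
  move=> [i _] /=; rewrite in_itv /= => /andP[h ->]; rewrite andbT.
  by apply: lt_le_trans h; rewrite divr_gt0// ltr_wpDl.
apply: ge0_integral_bigcup_le => //.
- move=> i j ij; apply/subsetPset => x /=; rewrite !in_itv /= => /andP[h ->].
  rewrite andbT; apply: le_trans h; rewrite ler_pM2l// lef_pV2 ?posrE ?ltr_wpDl//.
  by rewrite lerD2r ler_nat.
- exact: measurable_EFin_powR.
- by move=> x; rewrite lee_fin powR_ge0.
move=> i; rewrite integral_powR_cc ?gt_eqF//.
- by rewrite lee_fin gerBl divr_ge0 ?powR_ge0// ltW.
- by rewrite divr_gt0// ltr_wpDl.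
- by rewrite ltr_pdivrMr ?ltr_wpDl// ltr_pMr// ltrDr.
Qed.

Lemma integral_powR_cy_le (R : realType) (e A : R) : 0 < e -> 0 < A ->
  (\int[lebesgue_measure]_(x in `[A, +oo[) (x `^ (- (1 + e)))%:E <=
   (A `^ (- e) / e)%:E)%E.
Proof.
move=> e0 A0.
have -> : `[A, +oo[%classic = \bigcup_i `[A, A + i.+1%:R]%classic.
  apply/seteqP; split => x /=; rewrite ?in_itv /= ?andbT.
    move=> Ax; exists (Num.truncn (x - A)) => //=.
    by rewrite in_itv /= Ax/= -lerBlDl ltW// truncnS_gt.
  by move=> [i _] /=; rewrite in_itv /= => /andP[].
apply: ge0_integral_bigcup_le => //.
- move=> i j ij; apply/subsetPset => x /=; rewrite !in_itv /= => /andP[-> h] /=.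
  by apply: (le_trans h); rewrite lerD2l ler_nat.
- exact: measurable_EFin_powR.
- by move=> x; rewrite lee_fin powR_ge0.
have ee : - (1 + e) + 1 = - e by lra.
move=> i; rewrite integral_powR_cc ?ee ?oppr_eq0 ?gt_eqF//; last by rewrite ltrDl.
rewrite lee_fin !invrN !mulrN opprK addrC gerBl divr_ge0 ?powR_ge0//.
exact: ltW.
Qed.

Lemma measurable_cut_powR (R : realType) (t A e : R) :
  measurable_fun [set: measurableTypeR R]
    (fun x : R => (x `^ t * Num.max A x `^ e)%:E).
Proof.
apply/measurable_EFinP; apply: measurable_funM; first exact: measurable_powR.
apply: (measurableT_comp (f := fun y : R => y `^ e)); first exact: measurable_powR.
by apply: measurable_maxr => //; exact: measurable_cst.
Qed.

(** The cut separates the two sources of divergence: below [A] the maximum is constant and [-1 < t]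
    gives integrability at 0; above [A] the integrand is [x^(-1-e)]. The bound scales as [A^(-e)],
    as do those for the other two cuts below, so that the factors multiply well. *)
Lemma integral_cut_powR_le (R : realType) (t e A : R) :
  -1 < t -> 0 < e -> 0 < A ->
  (\int[lebesgue_measure]_(x in `[0%R, +oo[)
     (x `^ t * Num.max A x `^ (- (t + 1 + e)))%:E <=
   (((t + 1)^-1 + e^-1) * A `^ (- e))%:E)%E.
Proof.
move=> t1 e0 A0.
have t10 : 0 < t + 1 by lra.
have mf := @measurable_cut_powR R t A (- (t + 1 + e)).
have f0 (x : R) : (0 <= (x `^ t * Num.max A x `^ (- (t + 1 + e)))%:E)%E.
  by rewrite lee_fin mulr_ge0 ?powR_ge0.
have -> : `[0%R, +oo[%classic = `[0%R, A] `|` `]A, +oo[ :> set R.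
  apply/seteqP; split => x /=; rewrite !in_itv /= !andbT.
    by move=> ->; case: (leP x A); [left|right].
  by case=> [/andP[]|Ax] //; apply: ltW; exact: lt_trans Ax.
rewrite ge0_integral_setU//; first last.
- rewrite disj_set2E; apply/eqP; rewrite -subset0 => x [] /=.
  by rewrite !in_itv /= andbT => /andP[_ xA]; rewrite ltNge xA.
- exact: measurable_funTS.
rewrite mulrDl EFinD; apply: leeD.
- have -> : (\int[lebesgue_measure]_(x in `[0%R, A])
     (x `^ t * Num.max A x `^ (- (t + 1 + e)))%:E =
     \int[lebesgue_measure]_(x in `[0%R, A])
     ((A `^ (- (t + 1 + e)))%:E * (x `^ t)%:E))%E.
    apply: eq_integral => x; rewrite inE /= in_itv /= => /andP[_ xA].
    by rewrite -EFinM mulrC; congr (_ `^ _ * _)%:E; apply/max_idPl.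
  rewrite ge0_integralZl//; first last.
  + by rewrite lee_fin powR_ge0.
  + by move=> x _; rewrite lee_fin powR_ge0.
  + by apply: measurable_funTS; exact: measurable_EFin_powR.
  apply: (@le_trans _ _ ((A `^ (- (t + 1 + e)))%:E * (A `^ (t + 1) / (t + 1))%:E)%E).
    by apply: lee_wpmul2l; [rewrite lee_fin powR_ge0|exact: integral_powR_0c_le].
  rewrite -EFinM lee_fin mulrA -powRD; last by apply/implyP => _; rewrite gt_eqF.
  by have -> : - (t + 1 + e) + (t + 1) = - e; [lra | rewrite mulrC].
- apply: (@le_trans _ _ (\int[lebesgue_measure]_(x in `[A, +oo[)
     (x `^ (- (1 + e)))%:E)%E); last first.
    by apply: (le_trans (integral_powR_cy_le e0 A0)); rewrite lee_fin mulrC.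
  rewrite -integral_itv_obnd_cbnd; last first.
    by apply: measurable_funTS; exact: measurable_EFin_powR.
  apply: ge0_le_integral => //.
  + exact: measurable_funTS.
  + by apply: measurable_funTS; exact: measurable_EFin_powR.
  move=> x; rewrite /= in_itv /= andbT => Ax.
  rewrite lee_fin (max_idPr (ltW Ax)) -powRD; last first.
    by apply/implyP => _; rewrite gt_eqF// (lt_trans A0 Ax).
  by have -> : t - (t + 1 + e) = - (1 + e) by lra.
Qed.

Lemma ge0_even_integral_le (R : realType) (f : R -> \bar R) (M : \bar R) :
  measurable_fun [set: R] f -> (forall x, 0 <= f x)%E ->
  (forall x, f (- x) = f x) ->
  (\int[lebesgue_measure]_(x in `[0%R, +oo[) f x <= M)%E ->
  (\int[lebesgue_measure]_x f x <= M + M)%E.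
Proof.
move=> mf f0 ef hM.
have h2 : (\int[lebesgue_measure]_(x in `]-oo, 0%R]) f x <= M)%E.
  apply: le_trans hM; rewrite ge0_integration_by_substitution0//.
  by under [in leRHS]eq_integral do rewrite ef.
have -> : [set: R] = `]-oo, 0%R] `|` `]0%R, +oo[.
  apply/seteqP; split => x //= _; rewrite !in_itv /= andbT.
  by case: (leP x 0); [left|right].
rewrite ge0_integral_setU//; first last.
- rewrite disj_set2E; apply/eqP; rewrite -subset0 => x [] /=.
  by rewrite !in_itv /= andbT => x0; rewrite ltNge x0.
- exact: measurable_funTS.
apply: leeD => //; apply: le_trans hM.
by rewrite integral_itv_obnd_cbnd//; exact: measurable_funTS.
Qed.

Lemma integral_cut_norm_le (R : realType) (e A : R) : 0 < e -> 0 < A ->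
  (\int[lebesgue_measure]_x (Num.max A `|x| `^ (- (1 + e)))%:E <=
   (2 * (1 + e^-1) * A `^ (- e))%:E)%E.
Proof.
move=> e0 A0.
have mf : measurable_fun [set: R] (fun x : R => (Num.max A `|x| `^ (- (1 + e)))%:E).
  apply/measurable_EFinP.
  apply: (measurableT_comp (f := fun y : R => y `^ _)); first exact: measurable_powR.
  by apply: measurable_maxr; [exact: measurable_cst|exact: normr_measurable].
have -> : 2 * (1 + e^-1) * A `^ (- e) =
  (1 + e^-1) * A `^ (- e) + (1 + e^-1) * A `^ (- e) by ring.
rewrite EFinD; apply: ge0_even_integral_le => //.
- by move=> x; rewrite lee_fin powR_ge0.
- by move=> x; rewrite normrN.
have := @integral_cut_powR_le R 0 e A ltac:(lra) e0 A0.
rewrite add0r invr1; apply: le_trans.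
rewrite le_eqVlt; apply/orP; left; apply/eqP.
apply: eq_integral => x; rewrite inE /= in_itv /= andbT => x0.
by rewrite powRr0 mul1r ger0_norm.
Qed.

(** [max(A, x^2)] is the square of [max(sqrt A, |x|)], so this is the preceding bound with [e]
    doubled and [A] replaced by its root; hence the critical exponent 1/2 instead of 1. *)
Lemma integral_cut_sqr_le (R : realType) (e A : R) : 0 < e -> 0 < A ->
  (\int[lebesgue_measure]_x (Num.max A (x ^+ 2) `^ (- (2^-1 + e)))%:E <=
   (2 * (1 + (2 * e)^-1) * A `^ (- e))%:E)%E.
Proof.
move=> e0 A0.
have e20 : 0 < 2 * e by lra.
have sA0 : 0 < Num.sqrt A by rewrite sqrtr_gt0.
have := integral_cut_norm_le e20 sA0.
have E2 (y b : R) : 0 <= y -> y `^ (2 * b) = (y ^+ 2) `^ b.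
  by move=> y0; rewrite powRrM powR_mulrn.
have -> : - (2 * e) = 2 * (- e) by ring.
rewrite (E2 (Num.sqrt A) (- e)) ?sqrtr_ge0// sqr_sqrtr; last exact: ltW.
move=> h; apply: le_trans h.
rewrite le_eqVlt; apply/orP; left; apply/eqP.
apply: eq_integral => x _; congr (_%:E).
have -> : - (1 + 2 * e) = 2 * (- (2^-1 + e)) by field.
rewrite E2 ?le_max ?sqrtr_ge0//; congr (_ `^ _).
rewrite maxEle maxEle.
have -> : (Num.sqrt A <= `|x|) = (A <= x ^+ 2).
  rewrite -[in LHS]sqrtr_sqr ler_sqrt ?sqr_ge0//.
by case: ifP => _; rewrite ?sqr_sqrtr ?(ltW A0)// ?real_normK ?num_real.
Qed.

(** * The tube domain *)

Section tube_geometry.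
Variables (R : realType) (n : nat).
Implicit Types z u : Cn R n.

Lemma measurable_xc j : measurable_fun [set: Cn R n] (fun u => xc u j).
Proof. exact: measurable_coord. Qed.

Lemma measurable_yc j : measurable_fun [set: Cn R n] (fun u => yc u j).
Proof. exact: measurable_coord. Qed.

Lemma measurable_sum_sqr_yc :
  measurable_fun [set: Cn R n] (fun u => \sum_(j < n.-1) yc u j ^+ 2).
Proof.
apply: measurable_sum => j; apply: measurable_funX; exact: measurable_yc.
Qed.

Lemma measurable_rho : measurable_fun [set: Cn R n] (@rho R n).
Proof.
apply: measurable_funB; [exact: measurable_yc|exact: measurable_sum_sqr_yc].
Qed.

Lemma TBE z : TB z = (0 < rho z) :> Prop.
Proof. by rewrite /TB /inB /rho /= subr_gt0. Qed.

Lemma measurable_TB : measurable (@TB R n).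
Proof.
have -> : @TB R n = @rho R n @^-1` `]0, +oo[.
  by apply/seteqP; split => z; rewrite TBE /= in_itv /= andbT.
by rewrite -[X in measurable X]setTI; apply: measurable_rho.
Qed.

(** Since [-(y+y')^2 = (y-y')^2 - 2y^2 - 2y'^2], the two negative terms turn [y_n + y_n'] into
    [rho z + rho u]. All terms are then nonnegative on the tube, and each of them bounds the real
    part from below. *)
Lemma Re_rho2 z u : complex.Re (rho2 z u) =
  (rho z + rho u) / 2 +
  4^-1 * \sum_(j < n.-1) ((xc z j - xc u j) ^+ 2 + (yc z j - yc u j) ^+ 2).
Proof.
rewrite /rho2 /rho.
have ReD (x y : R[i]) : complex.Re (x + y) = complex.Re x + complex.Re y.
  by case: x y => [? ?] [? ?].
have Re0 : complex.Re (0 : R[i]) = 0 by [].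
set S := \sum_(j < n.-1) (zc z j - _) ^+ 2.
have -> : complex.Re ((4^-1)%:C%C * (S - (2%:C%C * Complex 0 1) * (zc z n.-1 - cconj (zc u n.-1)))) =
   4^-1 * (complex.Re S + 2 * (yc z n.-1 + yc u n.-1)).
  by case: S => a b; rewrite /zc /cconj /=; ring.
rewrite /S (big_morph _ ReD Re0).
have -> : \sum_(j < n.-1) complex.Re ((zc z j - cconj (zc u j)) ^+ 2) =
  \sum_(j < n.-1) ((xc z j - xc u j) ^+ 2 + (yc z j - yc u j) ^+ 2)
  - 2 * \sum_(j < n.-1) yc z j ^+ 2 - 2 * \sum_(j < n.-1) yc u j ^+ 2.
  rewrite !mulr_sumr -!sumrB; apply: eq_bigr => j _.
  by rewrite /zc /cconj /= ?expr2 /=; ring.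
by field.
Qed.

(** Solved for the coordinate [x_n] of [u]: the subtracted shift involves only coordinates of [u]
    with index below [2(n-1)], the triangular form that [integral_shear_prod] needs. *)
Lemma Im_rho2 z u : complex.Im (rho2 z u) =
  (xc u n.-1 - (xc z n.-1 -
     \sum_(j < n.-1) (xc z j - xc u j) * (yc z j + yc u j))) / 2.
Proof.
rewrite /rho2.
have ImD (x y : R[i]) : complex.Im (x + y) = complex.Im x + complex.Im y.
  by case: x y => [? ?] [? ?].
have Im0 : complex.Im (0 : R[i]) = 0 by [].
set S := \sum_(j < n.-1) (zc z j - _) ^+ 2.
have -> : complex.Im ((4^-1)%:C%C * (S - (2%:C%C * Complex 0 1) * (zc z n.-1 - cconj (zc u n.-1)))) =
   4^-1 * (complex.Im S - 2 * (xc z n.-1 - xc u n.-1)).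
  by case: S => a b; rewrite /zc /cconj /=; ring.
rewrite /S (big_morph _ ImD Im0).
have -> : \sum_(j < n.-1) complex.Im ((zc z j - cconj (zc u j)) ^+ 2) =
  2 * \sum_(j < n.-1) (xc z j - xc u j) * (yc z j + yc u j).
  rewrite !mulr_sumr; apply: eq_bigr => j _.
  by rewrite /zc /cconj /= ?expr2 /=; ring.
by field.
Qed.

Lemma measurable_Re_rho2 z :
  measurable_fun [set: Cn R n] (fun u => complex.Re (rho2 z u)).
Proof.
have /funext -> := Re_rho2 z.
apply: measurable_funD.
  apply: measurable_funM; last exact: measurable_cst.
  by apply: measurable_funD; [exact: measurable_cst|exact: measurable_rho].
apply: measurable_funM; first exact: measurable_cst.
apply: measurable_sum => j; apply: measurable_funD; apply: measurable_funX;
  apply: measurable_funB; try exact: measurable_cst.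
- exact: measurable_xc.
- exact: measurable_yc.
Qed.

Lemma measurable_Im_rho2_shift z : measurable_fun [set: Cn R n]
  (fun u => xc z n.-1 -
     \sum_(j < n.-1) (xc z j - xc u j) * (yc z j + yc u j)).
Proof.
apply: measurable_funB; first exact: measurable_cst.
apply: measurable_sum => j; apply: measurable_funM.
- by apply: measurable_funB; [exact: measurable_cst|exact: measurable_xc].
- by apply: measurable_funD; [exact: measurable_cst|exact: measurable_yc].
Qed.

Lemma measurable_Im_rho2 z :
  measurable_fun [set: Cn R n] (fun u => complex.Im (rho2 z u)).
Proof.
have /funext -> := Im_rho2 z.
apply: measurable_funM; last exact: measurable_cst.
apply: measurable_funB; first exact: measurable_xc.
exact: measurable_Im_rho2_shift.
Qed.

Lemma measurable_cabs d (T : measurableType d) (D : set T) (f : T -> R[i]) :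
  measurable_fun D (fun x => complex.Re (f x)) ->
  measurable_fun D (fun x => complex.Im (f x)) ->
  measurable_fun D (fun x => cabs (f x)).
Proof.
move=> mr mi; rewrite /cabs.
under eq_fun do rewrite -powR12_sqrt ?addr_ge0 ?sqr_ge0//.
apply: (measurableT_comp (measurable_powR 2^-1)).
by apply: measurable_funD; apply: measurable_funX.
Qed.

Lemma cabs_ge0 (w : R[i]) : 0 <= cabs w. Proof. exact: sqrtr_ge0. Qed.

Lemma Re_le_cabs (w : R[i]) : `|complex.Re w| <= cabs w.
Proof.
by rewrite /cabs -sqrtr_sqr ler_wsqrtr// lerDl sqr_ge0.
Qed.

Lemma Im_le_cabs (w : R[i]) : `|complex.Im w| <= cabs w.
Proof.
by rewrite /cabs -sqrtr_sqr ler_wsqrtr// lerDr sqr_ge0.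
Qed.

Lemma cabs_le (w : R[i]) : cabs w <= `|complex.Re w| + `|complex.Im w|.
Proof.
rewrite /cabs; set a := complex.Re w; set b := complex.Im w.
have h : 0 <= `|a| + `|b| by rewrite addr_ge0.
rewrite -[leRHS]ger0_norm// -sqrtr_sqr ler_wsqrtr//.
rewrite sqrrD !real_normK ?num_real// -addrA lerD2l lerDr.
by rewrite mulrn_wge0// mulr_ge0.
Qed.

Lemma Re_rho2_ge z u : (rho z + rho u) / 2 <= complex.Re (rho2 z u).
Proof.
rewrite Re_rho2 lerDl mulr_ge0// sumr_ge0// => j _.
by rewrite addr_ge0 ?sqr_ge0.
Qed.

Lemma cabs_rho2_ge z u : (rho z + rho u) / 2 <= cabs (rho2 z u).
Proof.
apply: (le_trans (Re_rho2_ge z u)).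
exact: le_trans (ler_norm _) (Re_le_cabs _).
Qed.

Lemma cabs_rho2_gt0 z u : TB z -> TB u -> 0 < cabs (rho2 z u).
Proof.
move=> Tz Tu; apply: lt_le_trans (cabs_rho2_ge z u).
by move: Tz Tu; rewrite !TBE => *; rewrite divr_gt0// addr_gt0.
Qed.

Lemma cabs_rho2_ge_coord z u i : TB z -> TB u -> (i < 2 * n.-1)%N ->
  (coord u i - coord z i) ^+ 2 <= 4 * cabs (rho2 z u).
Proof.
move=> Tz Tu i2.
have hj : (i./2 < n.-1)%N by rewrite ltn_half_double -mul2n.
suff h : (coord u i - coord z i) ^+ 2 <= 4 * complex.Re (rho2 z u).
  apply: (le_trans h); rewrite ler_pM2l//.
  exact: le_trans (ler_norm _) (Re_le_cabs _).
rewrite Re_rho2 (bigD1 (Ordinal hj)) //=.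
have r0 : 0 <= (rho z + rho u) / 2.
  by move: Tz Tu; rewrite !TBE => *; rewrite divr_ge0// addr_ge0// ltW.
set S := \sum_(_ < _ | _) _.
have S0 : 0 <= S by rewrite sumr_ge0// => j _; rewrite addr_ge0 ?sqr_ge0.
(* Even indices carry real parts and odd ones imaginary parts; both belong to the complex coordinate
   [i./2]. *)
have hi : (coord u i - coord z i) ^+ 2 = (xc z i./2 - xc u i./2) ^+ 2 \/
          (coord u i - coord z i) ^+ 2 = (yc z i./2 - yc u i./2) ^+ 2.
  have := odd_double_half i; case: (odd i) => /= E; [right|left].
  - have {1 2}-> : i = (2 * i./2 + 1)%N by rewrite -[in LHS]E addnC mul2n.
    by rewrite -sqrrN opprB.
  - have {1 2}-> : i = (2 * i./2)%N by rewrite -[in LHS]E mul2n.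
    by rewrite -sqrrN opprB.
have := sqr_ge0 (xc z i./2 - xc u i./2).
have := sqr_ge0 (yc z i./2 - yc u i./2).
by case: hi => ->; lra.
Qed.

End tube_geometry.

(** * Integral estimate for the kernel *)

Lemma lee_prod (R : realDomainType) (I : Type) (r : seq I) (f g : I -> \bar R) :
  (forall i, 0 <= f i <= g i)%E ->
  (\prod_(i <- r) f i <= \prod_(i <- r) g i)%E.
Proof.
move=> fg; elim: r => [|i r IH]; first by rewrite !big_nil.
have /andP[f0 fgi] := fg i.
rewrite !big_cons; apply: lee_pmul => //.
by apply: prode_ge0 => j _; have /andP[] := fg j.
Qed.

Section kernel_integral.
Variables (R : realType) (n : nat) (t s : R).
Hypotheses (n0 : (0 < n)%N) (t1 : -1 < t) (ts : n%:R + 1 + t < s).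

(** The one-variable factors have critical exponents [t+1] (for [rho u]), 1 (for [x_n]) and 1/2 for
    each of the other [2(n-1)] coordinates, in total [n+1+t]. The excess of [s] over this is shared
    equally among the [2n] coordinates. *)
Let e := (s - (n%:R + 1 + t)) / (2 * n)%:R.

Let e_gt0 : 0 < e.
Proof. by rewrite divr_gt0 ?subr_gt0// ltr0n muln_gt0. Qed.

Let expE : s = (t + 1 + e) + (1 + e) + (2^-1 + e) * (2 * n.-1)%:R.
Proof.
have nE : n%:R = n.-1%:R + 1 :> R by rewrite -[in LHS](prednK n0) -natr1.
have h : e * (2 * n%:R) = s - (n%:R + 1 + t).
  by rewrite /e natrM mulfVK// mulf_neq0 ?pnatr_eq0 -?lt0n.
rewrite natrM; move: h; rewrite nE; lra.
Qed.

(** Index [2(n-1)] is [x_n] and the next one is [y_n], which the shear [sig] turns into [rho u]. The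
    value 0 on negative arguments keeps this last factor integrable when the integral over the tube
    is enlarged to the whole space. *)
Let fac (A : R) (i : nat) (x : R) : R :=
  if i == (2 * n.-1).+1 then
    (if 0 <= x then x `^ t * Num.max A x `^ (- (t + 1 + e)) else 0)
  else if i == (2 * n.-1)%N then Num.max A `|x| `^ (- (1 + e))
  else Num.max A (x ^+ 2) `^ (- (2^-1 + e)).

Let sig (z : Cn R n) (i : nat) (u : Cn R n) : R :=
  if i == (2 * n.-1).+1 then \sum_(j < n.-1) yc u j ^+ 2
  else if i == (2 * n.-1)%N then xc z n.-1 -
     \sum_(j < n.-1) (xc z j - xc u j) * (yc z j + yc u j)
  else coord z i.

Let K : R := (t + 1)^-1 + e^-1 + 2 * (1 + e^-1) + 2 * (1 + (2 * e)^-1).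

Let fac_ge0 A i x : 0 <= fac A i x.
Proof.
rewrite /fac; case: ifP => _.
  by case: ifP => // _; rewrite mulr_ge0 ?powR_ge0.
by case: ifP => _; rewrite powR_ge0.
Qed.

Let measurable_fac A i : measurable_fun [set: R] (fac A i).
Proof.
rewrite /fac; case: (i == _.+1).
  apply: measurable_fun_ifT; last exact: measurable_cst.
  - by apply: measurable_fun_ler => //; exact: measurable_cst.
  - by apply/measurable_EFinP; exact: measurable_cut_powR.
case: (i == _).
  apply: (measurableT_comp (measurable_powR _)).
  by apply: measurable_maxr; [exact: measurable_cst|exact: normr_measurable].
apply: (measurableT_comp (measurable_powR _)).
by apply: measurable_maxr; [exact: measurable_cst|exact: measurable_funX].
Qed.

Let integral_fac_le A i : 0 < A ->
  (\int[lebesgue_measure]_x (fac A i x)%:E <= (K * A `^ (- e))%:E)%E.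
Proof.
move=> A0.
have t10 : 0 < (t + 1)^-1 by rewrite invr_gt0; have := t1; lra.
have e10 : 0 < e^-1 by rewrite invr_gt0.
have e20 : 0 < (2 * e)^-1 by rewrite invr_gt0 mulr_gt0.
have KA c : c <= K -> ((c * A `^ (- e))%:E <= (K * A `^ (- e))%:E)%E.
  by move=> cK; rewrite lee_fin ler_wpM2r// powR_ge0.
rewrite /fac; case: (i == _.+1).
  apply: (@le_trans _ _ (((t + 1)^-1 + e^-1) * A `^ (- e))%:E); last first.
    by apply: KA; rewrite /K; lra.
  apply: le_trans (integral_cut_powR_le t1 e_gt0 A0).
  rewrite le_eqVlt; apply/orP; left; apply/eqP.
  rewrite [RHS]integral_mkcond; apply: eq_integral => x _.
  rewrite patchE; have -> : (x \in `[0%R, +oo[%classic) = (0 <= x).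
    by apply/idP/idP; rewrite inE /= in_itv /= andbT.
  by case: ifP.
case: (i == _).
  apply: le_trans (integral_cut_norm_le e_gt0 A0) _.
  by apply: KA; rewrite /K; lra.
apply: le_trans (integral_cut_sqr_le e_gt0 A0) _.
by apply: KA; rewrite /K; lra.
Qed.

Let measurable_sig z i : measurable_fun [set: Cn R n] (sig z i).
Proof.
rewrite /sig; case: (i == _.+1); first exact: measurable_sum_sqr_yc.
case: (i == _); first exact: measurable_Im_rho2_shift.
exact: measurable_cst.
Qed.

Let sig_prefix z i (u v : Cn R n) :
  (forall j, (j < i)%N -> coord u j = coord v j) -> sig z i u = sig z i v.
Proof.
move=> h; rewrite /sig.
have ltx (j : 'I_n.-1) : (2 * j < 2 * n.-1)%N by rewrite ltn_pmul2l.
have lty (j : 'I_n.-1) : (2 * j + 1 < 2 * n.-1)%N.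
  by have := ltn_ord j; rewrite -(leq_pmul2l (m := 2)) // mulnS addn1.
case: eqP => [iE|_].
  by apply: eq_bigr => j _; rewrite /yc h// iE ltnS ltnW.
case: eqP => [iE|//]; congr (_ - _).
by apply: eq_bigr => j _; rewrite /xc /yc !h// iE.
Qed.

Let powR_antitone (a b c : R) : 0 < a -> a <= b -> 0 <= c ->
  b `^ (- c) <= a `^ (- c).
Proof.
move=> a0 ab c0; have b0 := lt_le_trans a0 ab.
rewrite !powRN lef_pV2 ?posrE ?powR_gt0//.
by rewrite ge0_ler_powR// nnegrE ltW.
Qed.

(** Every cut variable is at most [Q] and the exponents are negative, so in each of the [2n] shares
    of [Q^(-s)] the number [Q] may be replaced by a different cut variable. *)
Let prod_fac_ge (z u : Cn R n) : TB z -> TB u ->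
  rho u `^ t * cabs (rho2 z u) `^ (- s) <=
  4 `^ s * \prod_(0 <= i < 2 * n) fac (rho z) i (coord u i - sig z i u).
Proof.
move=> Tz Tu; have := Tz; have := Tu; rewrite !TBE => ru rz.
set Q := 4 * cabs (rho2 z u).
have absE : cabs (rho2 z u) `^ (- s) = 4 `^ s * Q `^ (- s).
  by rewrite /Q powRM ?cabs_ge0// mulrA [4 `^ (- s)]powRN mulfV ?mul1r// gt_eqF// powR_gt0.
have Q0 : 0 < Q by rewrite mulr_gt0// cabs_rho2_gt0.
have hQ := cabs_rho2_ge z u.
have QA : rho z <= Q by rewrite /Q; lra.
have Qr : rho u <= Q by rewrite /Q; lra.
have nE : (2 * n = (2 * n.-1).+2)%N by rewrite -[in LHS](prednK n0) mulnS.
rewrite absE mulrCA ler_wpM2l ?powR_ge0//.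
have splitE (F : nat -> R) : \prod_(0 <= i < 2 * n) F i =
    \prod_(0 <= i < 2 * n.-1) F i * F (2 * n.-1)%N * F (2 * n.-1).+1.
  by rewrite nE big_nat_recr//= big_nat_recr.
rewrite (splitE (fun i => fac (rho z) i (coord u i - sig z i u))).
have last_fac : rho u `^ t * Q `^ (- (t + 1 + e)) <=
    fac (rho z) (2 * n.-1).+1 (coord u (2 * n.-1).+1 - sig z (2 * n.-1).+1 u).
  rewrite /fac /sig eqxx.
  have -> : coord u (2 * n.-1).+1 - \sum_(j < n.-1) yc u j ^+ 2 = rho u.
    by rewrite /rho /yc addn1.
  rewrite (ltW ru) ler_wpM2l ?powR_ge0// powR_antitone//.
  - by rewrite lt_max rz.
  - by rewrite ge_max QA.
  - by have := e_gt0; have := t1; lra.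
have mid_fac : Q `^ (- (1 + e)) <=
    fac (rho z) (2 * n.-1) (coord u (2 * n.-1) - sig z (2 * n.-1) u).
  rewrite /fac /sig ltn_eqF// eqxx powR_antitone//.
  - by rewrite lt_max rz.
  - rewrite ge_max QA /=.
    have := Im_le_cabs (rho2 z u); rewrite Im_rho2 normrM.
    rewrite [X in _ * X]ger0_norm ?invr_ge0// -/(xc u n.-1) ler_pdivrMr// => h.
    apply: (le_trans h); rewrite /Q.
    by have := cabs_ge0 (rho2 z u); lra.
  - by have := e_gt0; lra.
have first_fac : Q `^ (- ((2^-1 + e) * (2 * n.-1)%:R)) <=
    \prod_(0 <= i < 2 * n.-1) fac (rho z) i (coord u i - sig z i u).
  have -> : Q `^ (- ((2^-1 + e) * (2 * n.-1)%:R)) =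
      \prod_(0 <= i < 2 * n.-1) Q `^ (- (2^-1 + e)).
    by rewrite prodr_const_nat subn0 -mulNr powRrM powR_mulrn// powR_ge0.
  rewrite !big_mkord; apply: ler_prod => i _; rewrite powR_ge0 /=.
  have i2 := ltn_ord i.
  rewrite /fac /sig (ltn_eqF (ltnW i2 : (i < (2 * n.-1).+1)%N)) (ltn_eqF i2).
  rewrite powR_antitone//.
  - by rewrite lt_max rz.
  - by rewrite ge_max QA cabs_rho2_ge_coord.
  - by have := e_gt0; lra.
have Q1 : Q `^ (- s) = Q `^ (- ((2^-1 + e) * (2 * n.-1)%:R)) * Q `^ (- (1 + e))
    * Q `^ (- (t + 1 + e)).
  have Qn0 x : (x == 0) ==> (Q != 0) by apply/implyP => _; rewrite gt_eqF.
  rewrite -powRD ?Qn0// -powRD ?Qn0//; congr (_ `^ _); rewrite [in LHS]expE; ring.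
rewrite Q1 mulrCA.
by apply: ler_pM => //; rewrite ?mulr_ge0 ?powR_ge0//; apply: ler_pM => //; rewrite powR_ge0.
Qed.

(** Each of the [2n] one-variable integrals contributes the same power [rho z ^ (-e)], and
    [2n e = s - (n+1+t)] yields the exponent on the right. *)
Lemma integral_rho2_le : exists2 C : R, 0 <= C & forall z : Cn R n, TB z ->
  (\int[dV R n]_(u in @TB R n) (rho u `^ t * cabs (rho2 z u) `^ (- s))%:E <=
   (C * rho z `^ (n%:R + 1 + t - s))%:E)%E.
Proof.
have K0 : 0 <= K.
  have h1 : 0 < (t + 1)^-1 by rewrite invr_gt0; have := t1; lra.
  have h2 : 0 < e^-1 by rewrite invr_gt0.
  have h3 : 0 < (2 * e)^-1 by rewrite invr_gt0 mulr_gt0.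
  by rewrite /K; lra.
exists (4 `^ s * K ^+ (2 * n)) => [|z Tz]; first by rewrite mulr_ge0 ?powR_ge0 ?exprn_ge0.
have := Tz; rewrite TBE => rz.
pose P (u : Cn R n) : \bar R :=
  (\prod_(0 <= i < 2 * n) (fac (rho z) i (coord u i - sig z i u))%:E)%E.
have mP : measurable_fun [set: Cn R n] P.
  apply: emeasurable_prod => i; apply/measurable_EFinP.
  apply: (measurableT_comp (measurable_fac _ _)).
  by apply: measurable_funB; [exact: measurable_coord|exact: measurable_sig].
have P0 u : (0 <= P u)%E by apply: prode_ge0 => i _; rewrite lee_fin fac_ge0.
apply: (@le_trans _ _ (\int[dV R n]_(u in @TB R n) ((4 `^ s)%:E * P u))%E).
  apply: ge0_le_integral => //.
  - exact: measurable_TB.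
  - by move=> u _; rewrite lee_fin mulr_ge0 ?powR_ge0.
  - apply: measurable_funTS; apply/measurable_EFinP; apply: measurable_funM.
      apply: (measurableT_comp (measurable_powR _)); exact: measurable_rho.
    apply: (measurableT_comp (measurable_powR _)); apply: measurable_cabs.
    + exact: measurable_Re_rho2.
    + exact: measurable_Im_rho2.
  - by apply: measurable_funTS; apply: measurable_funeM.
  - by move=> u Tu; rewrite /P prodEFin -EFinM lee_fin prod_fac_ge.
apply: (@le_trans _ _ (\int[dV R n]_u ((4 `^ s)%:E * P u))%E).
  apply: ge0_subset_integral => //.
  - exact: measurable_TB.
  - by apply: measurable_funeM.
  - by move=> u _; rewrite mule_ge0// lee_fin powR_ge0.
rewrite ge0_integralZl//.
rewrite -mulrA EFinM; apply: lee_wpmul2l; first by rewrite lee_fin powR_ge0.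
have /= -> := @integral_shear_prod R (2 * n) (fun i x => (fac (rho z) i x)%:E) (sig z)
  (fun i => measurableT_comp (@EFin_measurable _ _) (measurable_fac _ _))
  (fun i x => fac_ge0 _ _ _) (measurable_sig z) (sig_prefix z).
have -> : K ^+ (2 * n) * rho z `^ (n%:R + 1 + t - s) =
    \prod_(0 <= i < 2 * n) (K * rho z `^ (- e)).
  rewrite prodr_const_nat subn0 exprMn; congr (_ * _).
  rewrite -powR_mulrn ?powR_ge0// -powRrM; congr (_ `^ _).
  rewrite mulNr /e mulfVK; first by ring.
  by rewrite pnatr_eq0 -lt0n muln_gt0.
rewrite -prodEFin.
apply: lee_prod => i; rewrite integral_fac_le// andbT.
by apply: integral_ge0 => x _; rewrite lee_fin fac_ge0.
Qed.
End kernel_integral.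

(** * Polar form of the kernels *)

Lemma measurable_invr (R : realType) :
  measurable_fun [set: R] (fun x : R => x^-1).
Proof.
have -> : (fun x : R => x^-1) =
    (fun x => if 0 <= x then x `^ (-1) else - ((- x) `^ (-1))).
  apply/funext => x; case: (leP 0 x) => x0; first by rewrite powR_inv1.
  by rewrite powR_inv1 ?oppr_ge0 ?ltW// invrN opprK.
apply: measurable_fun_ifT.
- by apply: measurable_fun_ler => //; exact: measurable_cst.
- exact: measurable_powR.
- apply: measurableT_comp => //.
  by apply: (measurableT_comp (measurable_powR (-1))).
Qed.

Section kernels.
Variables (R : realType) (n : nat).
Local Notation C2 := (Cn R n * Cn R n)%type.

Definition kmod (b1 b2 c1 c2 : R) (zw ue : C2) : R :=
  (rho ue.1 `^ b1 * cabs (rho2 zw.1 ue.1) `^ (- c1)) *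
  (rho ue.2 `^ b2 * cabs (rho2 zw.2 ue.2) `^ (- c2)).

Definition karg (c1 c2 : R) (zw ue : C2) : R :=
  c1 * atan (complex.Im (rho2 zw.1 ue.1) / complex.Re (rho2 zw.1 ue.1)) +
  c2 * atan (complex.Im (rho2 zw.2 ue.2) / complex.Re (rho2 zw.2 ue.2)).

(** This is [r e^(-it)]; the minus sign is there because [cpow] stands in the denominator of
    [kerT]. *)
Definition polar (r t : R) : R[i] := Complex (r * cos t) (- (r * sin t)).

Lemma kmod_ge0 b1 b2 c1 c2 zw ue : 0 <= kmod b1 b2 c1 c2 zw ue.
Proof. by rewrite /kmod !mulr_ge0 ?powR_ge0. Qed.

Lemma kerSE b1 b2 c1 c2 zw ue :
  kerS n b1 b2 c1 c2 zw ue = polar (kmod b1 b2 c1 c2 zw ue) 0.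
Proof.
rewrite /kerS /polar cos0 sin0 mulr1 mulr0 oppr0 /kmod !powRN invfM.
by congr Complex; rewrite mulrACA.
Qed.

Lemma kerTE b1 b2 c1 c2 zw ue :
  kerT n b1 b2 c1 c2 zw ue =
  polar (kmod b1 b2 c1 c2 zw ue) (karg c1 c2 zw ue).
Proof.
have polarM r r' t t' : polar r t * polar r' t' = polar (r * r') (t + t').
  by rewrite /polar /= cosD sinD; congr Complex; ring.
have cpowV w c : (cpow w c)^-1 =
    polar (cabs w `^ (- c)) (c * atan (complex.Im w / complex.Re w)).
  rewrite powRN /cpow /=; set r := cabs w `^ c; set t := c * _.
  (* Where the power of the modulus vanishes both sides are 0, as [0^-1 = 0]; thus the polar form
     holds at all points, also off the tube. *)
  have [->|r0] := eqVneq r 0.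
    rewrite !mul0r (_ : Complex 0 0 = 0 :> R[i])// invr0 /polar invr0 !mul0r oppr0.
    by [].
  have h : Complex (r * cos t) (r * sin t) * polar r^-1 t = 1.
    rewrite /polar /=; congr Complex.
    - have -> : r * cos t * (r^-1 * cos t) - r * sin t * - (r^-1 * sin t) =
        (r / r) * (cos t ^+ 2 + sin t ^+ 2) by ring.
      by rewrite cos2Dsin2 mulr1 mulfV.
    - ring.
  have hn : Complex (r * cos t) (r * sin t) != 0 :> R[i].
    apply/eqP => h0; move: h; rewrite h0 mul0r => /eqP.
    by rewrite eq_sym oner_eq0.
  by apply: (mulfI hn); rewrite h mulfV.
rewrite /kerT invfM !cpowV polarM.
have -> (x : R) : x%:C%C = polar x 0.
  by rewrite /polar cos0 sin0 mulr1 mulr0 oppr0.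
by rewrite polarM add0r /kmod mulrACA.
Qed.

Lemma measurable_atan_slope z : measurable_fun [set: Cn R n]
  (fun u => atan (complex.Im (rho2 z u) / complex.Re (rho2 z u))).
Proof.
apply: (measurableT_comp (f := @atan R)).
  by apply: continuous_measurable_fun; exact: continuous_atan.
apply: measurable_funM; first exact: measurable_Im_rho2.
apply: (measurableT_comp (f := fun x : R => x^-1)); last exact: measurable_Re_rho2.
exact: measurable_invr.
Qed.

Lemma measurable_karg c1 c2 zw : measurable_fun [set: C2] (karg c1 c2 zw).
Proof.
apply: measurable_funD; apply: measurable_funM; try exact: measurable_cst.
- exact: (measurableT_comp (measurable_atan_slope zw.1) measurable_fst).
- exact: (measurableT_comp (measurable_atan_slope zw.2) measurable_snd).
Qed.

Lemma measurable_kfactor (b c : R) z : measurable_fun [set: Cn R n]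
  (fun u => rho u `^ b * cabs (rho2 z u) `^ (- c)).
Proof.
apply: measurable_funM.
  apply: (measurableT_comp (measurable_powR _)); exact: measurable_rho.
apply: (measurableT_comp (measurable_powR _)); apply: measurable_cabs.
- exact: measurable_Re_rho2.
- exact: measurable_Im_rho2.
Qed.

Lemma measurable_kmod b1 b2 c1 c2 zw :
  measurable_fun [set: C2] (kmod b1 b2 c1 c2 zw).
Proof.
apply: measurable_funM.
- exact: (measurableT_comp (measurable_kfactor b1 c1 zw.1) measurable_fst).
- exact: (measurableT_comp (measurable_kfactor b2 c2 zw.2) measurable_snd).
Qed.

Lemma cabsM (v w : R[i]) : cabs (v * w) = cabs v * cabs w.
Proof.
rewrite /cabs -sqrtrM; last by rewrite addr_ge0 ?sqr_ge0.
by case: v w => [a b] [c d] /=; congr Num.sqrt; ring.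
Qed.

Lemma cabs_real (x : R) : 0 <= x -> cabs (x%:C%C) = x.
Proof. by move=> x0; rewrite /cabs /= expr0n /= addr0 sqrtr_sqr ger0_norm. Qed.

Lemma cabs_polar r t : 0 <= r -> cabs (polar r t) = r.
Proof.
move=> r0; rewrite /cabs /= sqrrN !exprMn -mulrDr cos2Dsin2 mulr1 sqrtr_sqr.
exact: ger0_norm.
Qed.

End kernels.

(** * Sufficiency *)

Section sufficiency.
Variables (R : realType) (n : nat) (p1 a1 a2 b1 b2 c1 c2 al1 al2 : R).
Hypotheses (n0 : (0 < n)%N) (p1_gt1 : 1 < p1).
Local Notation C2 := (Cn R n * Cn R n)%type.
Local Notation TT := (@TB R n `*` @TB R n).

Let TT_measurable : measurable TT.
Proof. by apply: measurableX; exact: measurable_TB. Qed.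

Section fixed_function.
Variable f : C2 -> R[i].
Hypotheses (mfr : measurable_fun TT (fun q => complex.Re (f q)))
  (mfi : measurable_fun TT (fun q => complex.Im (f q))).

(** Extended by 0, the modulus of [f] is measurable on the whole product, where Tonelli's theorem
    and Hoelder's inequality are applied; [f] itself is controlled on [TT] only. *)
Let F : C2 -> R := (fun q => cabs (f q)) \_ TT.

Let F_ge0 q : 0 <= F q.
Proof. by rewrite /F patchE; case: ifP => // _; exact: cabs_ge0. Qed.

Let F_out q : ~ TT q -> F q = 0.
Proof. by move=> h; rewrite /F patchE memNset. Qed.

Let F_in q : TT q -> F q = cabs (f q).
Proof. by move=> h; rewrite /F patchE mem_set. Qed.

Let measurable_F : measurable_fun [set: C2] F.
Proof.
by apply/(measurable_restrictT _ TT_measurable); exact: measurable_cabs.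
Qed.

Let J (w : Cn R n) : \bar R :=
  (\int[dV R n]_u (F (u, w) `^ p1 * rho u `^ al1)%:E)%E.

Let measurable_J : measurable_fun [set: Cn R n] J.
Proof.
apply: (@measurable_fun_fubini_tonelli_G _ _ _ _ _ (dV R n)
  (fun q : C2 => (F q `^ p1 * rho q.1 `^ al1)%:E)).
- apply/measurable_EFinP; apply: measurable_funM.
    exact: (measurableT_comp (measurable_powR _)).
  apply: (measurableT_comp (measurable_powR _)).
  exact: (measurableT_comp (@measurable_rho R n) measurable_fst).
- by move=> q; rewrite lee_fin mulr_ge0 ?powR_ge0.
Qed.

Let p1_gt0 : 0 < p1. Proof. exact: lt_trans p1_gt1. Qed.

Lemma mixnorm_patchE : mixnorm p1 1 al1 al2 f =
  (\int[dV R n]_(w in @TB R n) (J w `^ p1^-1 * (rho w `^ al2)%:E))%E.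
Proof.
rewrite /mixnorm invr1 poweRe1; last first.
  by apply: integral_ge0 => w _; rewrite mule_ge0 ?poweR_ge0// lee_fin powR_ge0.
apply: eq_integral => w; rewrite inE => Tw; rewrite div1r.
suff -> : (\int[dV R n]_(z in @TB R n) (cabs (f (z, w)) `^ p1 * rho z `^ al1)%:E =
  J w)%E by [].
rewrite /J integral_mkcond; apply: eq_integral => u _; rewrite patchE.
case: ifPn => [|/negP]; rewrite inE => Tu; first by rewrite F_in.
by rewrite F_out ?powR0 ?mul0r ?gt_eqF// => -[].
Qed.

Hypotheses (a2_ge0 : 0 <= a2) (b2_ge : al2 <= b2) (c2E : c2 = a2 + b2 - al2).

Let q1 : R := p1 / (p1 - 1).
Let q1_gt0 : 0 < q1. Proof. by rewrite divr_gt0// subr_gt0. Qed.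
Let pq : q1^-1 + p1^-1 = 1.
Proof. by rewrite /q1; field; rewrite subr_eq0 !gt_eqF. Qed.

(* Hoelder's inequality in the first variable, against the weight
   [rho ^ al1] split as [rho ^ (al1 / p1)] and its inverse. *)
Lemma hoelder_inner (C : R) (z : Cn R n) (w : Cn R n) : 0 <= C -> TB z ->
  (\int[dV R n]_(u in @TB R n)
     (rho u `^ ((b1 - al1 / p1) * q1) * cabs (rho2 z u) `^ (- (c1 * q1)))%:E <=
   (C * rho z `^ (- (a1 * q1)))%:E)%E ->
  (\int[dV R n]_u (rho u `^ b1 * cabs (rho2 z u) `^ (- c1) * F (u, w))%:E <=
   (C `^ q1^-1 * rho z `^ (- a1))%:E * J w `^ p1^-1)%E.
Proof.
move=> C0 Tz hC.
have rz : 0 < rho z by move: Tz; rewrite TBE.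
(* Cut off to the tube because [hC] bounds the integral only there; nothing is lost, as [F] vanishes
   outside. *)
pose g (u : Cn R n) : R :=
  ((fun u => rho u `^ (b1 - al1 / p1) * cabs (rho2 z u) `^ (- c1)) \_ (@TB R n)) u.
pose h (u : Cn R n) : R := F (u, w) * rho u `^ (al1 / p1).
have mg : measurable_fun [set: Cn R n] g.
  apply/(measurable_restrictT _ (@measurable_TB R n)).
  by apply: measurable_funTS; exact: measurable_kfactor.
have mh : measurable_fun [set: Cn R n] h.
  apply: measurable_funM.
    exact: (measurableT_comp measurable_F (pair2_measurable w)).
  apply: (measurableT_comp (measurable_powR _)); exact: measurable_rho.
have := hoelder (dV R n) mg mh q1_gt0 p1_gt0 pq.
have g0 u : 0 <= g u by rewrite /g patchE; case: ifP => // _; rewrite mulr_ge0 ?powR_ge0.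
have h0 u : 0 <= h u by rewrite /h mulr_ge0 ?powR_ge0.
have gh0 u : 0 <= g u * h u by exact: mulr_ge0.
rewrite Lnorm1.
have -> : (\int[dV R n]_u (rho u `^ b1 * cabs (rho2 z u) `^ (- c1) * F (u, w))%:E =
   \int[dV R n]_x `|(EFin \o (g \* h)%R) x|)%E.
  apply: eq_integral => u _ /=; congr (_%:E).
  rewrite (ger0_norm (gh0 u)) /g /h patchE; case: ifPn => [|/negP]; rewrite inE => Tu.
    have ru : 0 < rho u by move: Tu; rewrite TBE.
    have -> : rho u `^ b1 = rho u `^ (b1 - al1 / p1) * rho u `^ (al1 / p1).
      by rewrite -powRD ?subrK//; apply/implyP => _; rewrite gt_eqF.
    by ring.
  by rewrite F_out ?mulr0 ?mul0r// => -[].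
move=> H; apply: (le_trans H).
apply: lee_pmul; rewrite ?Lnorm_ge0//.
- rewrite unlock /=.
  have -> : (C `^ q1^-1 * rho z `^ (- a1))%:E =
      ((C * rho z `^ (- (a1 * q1)))%:E `^ q1^-1)%E.
    rewrite poweR_EFin powRM ?powR_ge0// -powRrM mulNr mulfK//.
    by rewrite gt_eqF.
  apply: gt0_ler_poweR; rewrite ?invr_ge0 ?(ltW q1_gt0)//.
  + by rewrite in_itv /= leey andbT; apply: integral_ge0 => u _; rewrite lee_fin powR_ge0.
  + by rewrite in_itv /= leey andbT lee_fin mulr_ge0 ?powR_ge0.
  apply: le_trans hC; rewrite [leRHS]integral_mkcond.
  rewrite le_eqVlt; apply/orP; left; apply/eqP.
  apply: eq_integral => u _ /=; rewrite ger0_norm// /g !patchE.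
  case: ifPn => _; last by rewrite powR0// gt_eqF.
  by rewrite powRM ?powR_ge0// -!powRrM mulNr.
- rewrite unlock /= /J le_eqVlt; apply/orP; left; apply/eqP; congr (_ `^ _)%E.
  apply: eq_integral => u _ /=; rewrite ger0_norm// /h.
  by rewrite powRM ?powR_ge0// -powRrM mulfVK// gt_eqF.
Qed.

(** The outer norm is an L^1 norm, so the kernel has to be bounded by a multiple of the weight
    itself. The exponent splits as [c2 = a2 + (b2 - al2)] into nonnegative parts; the first is spent
    on [rho w / 2] and the second on [rho eta / 2], both at most [|rho2 w eta|]. *)
Lemma outer_factor_le (w eta : Cn R n) : TB w -> TB eta ->
  rho eta `^ b2 * cabs (rho2 w eta) `^ (- c2) <=
  2 `^ c2 * rho w `^ (- a2) * rho eta `^ al2.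
Proof.
move=> Tw Te; have h := cabs_rho2_ge w eta.
have := Tw; have := Te; rewrite !TBE => re rw.
have c0 := cabs_rho2_gt0 Tw Te.
set Q := cabs _ in h c0 *.
have nz (x : R) (c : bool) : 0 < x -> c ==> (x != 0).
  by move=> x0; apply/implyP => _; rewrite gt_eqF.
have anti (x y c : R) : 0 < x -> x / 2 <= y -> 0 <= c ->
    y `^ (- c) <= 2 `^ c * x `^ (- c).
  move=> x0 xy cc; have x20 : 0 < x / 2 by rewrite divr_gt0.
  have -> : 2 `^ c * x `^ (- c) = (x / 2) `^ (- c).
    by rewrite powRM ?invr_ge0 ?(ltW x0)// mulrC -powR_inv1// -powRrM mulrNN mul1r.
  rewrite !powRN lef_pV2 ?posrE ?powR_gt0 ?(lt_le_trans x20)//.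
  by rewrite ge0_ler_powR// nnegrE ltW// (lt_le_trans x20).
have h1 : Q `^ (- a2) <= 2 `^ a2 * rho w `^ (- a2).
  by apply: anti => //; lra.
have h2 : Q `^ (- (b2 - al2)) <= 2 `^ (b2 - al2) * rho eta `^ (- (b2 - al2)).
  by apply: anti => //; have := b2_ge; lra.
have -> : Q `^ (- c2) = Q `^ (- a2) * Q `^ (- (b2 - al2)).
  by rewrite -powRD ?nz// c2E; congr (_ `^ _); ring.
have -> : 2 `^ c2 = 2 `^ a2 * 2 `^ (b2 - al2) :> R.
  by rewrite -powRD ?nz// c2E; congr (_ `^ _); ring.
have -> : rho eta `^ al2 = rho eta `^ b2 * rho eta `^ (- (b2 - al2)).
  by rewrite -powRD ?nz//; congr (_ `^ _); ring.
have -> : 2 `^ a2 * 2 `^ (b2 - al2) * rho w `^ (- a2) *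
    (rho eta `^ b2 * rho eta `^ (- (b2 - al2))) =
  rho eta `^ b2 * (2 `^ a2 * rho w `^ (- a2) *
    (2 `^ (b2 - al2) * rho eta `^ (- (b2 - al2)))) by ring.
by rewrite ler_wpM2l ?powR_ge0// ler_pM ?powR_ge0.
Qed.

Lemma integral_kmod_le (C : R) (z w : Cn R n) : 0 <= C -> TB z -> TB w ->
  (\int[dV R n]_(u in @TB R n)
     (rho u `^ ((b1 - al1 / p1) * q1) * cabs (rho2 z u) `^ (- (c1 * q1)))%:E <=
   (C * rho z `^ (- (a1 * q1)))%:E)%E ->
  (\int[@dV2 R n]_(q in TT) (kmod b1 b2 c1 c2 (z, w) q * cabs (f q))%:E <=
   (C `^ q1^-1 * 2 `^ c2 * (rho z `^ (- a1) * rho w `^ (- a2)))%:E *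
   mixnorm p1 1 al1 al2 f)%E.
Proof.
move=> C0 Tz Tw hC.
pose k1 (u : Cn R n) := rho u `^ b1 * cabs (rho2 z u) `^ (- c1).
pose k2 (u : Cn R n) := rho u `^ b2 * cabs (rho2 w u) `^ (- c2).
have k10 u : 0 <= k1 u by rewrite mulr_ge0 ?powR_ge0.
have k20 u : 0 <= k2 u by rewrite mulr_ge0 ?powR_ge0.
pose H (q : C2) : \bar R := (k2 q.2 * (k1 q.1 * F q))%:E.
have mH : measurable_fun [set: C2] H.
  apply/measurable_EFinP; apply: measurable_funM.
    exact: (measurableT_comp (measurable_kfactor b2 c2 w) measurable_snd).
  apply: measurable_funM => //.
  exact: (measurableT_comp (measurable_kfactor b1 c1 z) measurable_fst).
have H0 q : (0 <= H q)%E.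
  by rewrite lee_fin; exact: mulr_ge0 (k20 _) (mulr_ge0 (k10 _) (F_ge0 _)).
have -> : (\int[@dV2 R n]_(q in TT) (kmod b1 b2 c1 c2 (z, w) q * cabs (f q))%:E =
    \int[@dV2 R n]_q H q)%E.
  rewrite integral_mkcond; apply: eq_integral => q _; rewrite patchE /H.
  case: ifPn => [|/negP]; rewrite inE => Tq.
    by rewrite F_in// /kmod /k1 /k2 /=; congr (_%:E); ring.
  by rewrite F_out// !mulr0.
have -> : (\int[@dV2 R n]_q H q = \int[dV R n]_w' \int[dV R n]_u H (u, w'))%E.
  exact: (@fubini_tonelli2 _ _ _ _ _ (dV R n) (dV R n) H mH H0).
have mHi : measurable_fun [set: Cn R n] (fun w' => \int[dV R n]_u H (u, w'))%E.
  exact: (@measurable_fun_fubini_tonelli_G _ _ _ _ _ (dV R n) H mH H0).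
rewrite mixnorm_patchE.
have cst0 : 0 <= C `^ q1^-1 * 2 `^ c2 * (rho z `^ (- a1) * rho w `^ (- a2)).
  by rewrite !mulr_ge0 ?powR_ge0.
have mG : measurable_fun [set: Cn R n] (fun w' => J w' `^ p1^-1 * (rho w' `^ al2)%:E)%E.
  apply: emeasurable_funM.
    exact: (measurableT_comp (measurable_poweR _)).
  apply/measurable_EFinP; apply: (measurableT_comp (measurable_powR _)).
  exact: measurable_rho.
have G0 w' : (0 <= J w' `^ p1^-1 * (rho w' `^ al2)%:E)%E.
  by rewrite mule_ge0 ?poweR_ge0// lee_fin powR_ge0.
rewrite -ge0_integralZl//; first last.
- exact: measurable_funTS.
- exact: measurable_TB.
rewrite [leRHS]integral_mkcond; apply: ge0_le_integral => //.
- by move=> w' _; apply: integral_ge0.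
- apply/(measurable_restrictT _ (@measurable_TB R n)).
  by apply: measurable_funTS; apply: measurable_funeM.
move=> w' _; rewrite patchE; case: ifPn => [|/negP]; rewrite inE => Tw'; last first.
  rewrite integral0_eq// => u _; rewrite /H F_out ?mulr0// => -[] //.
have -> : (\int[dV R n]_u H (u, w') =
    (k2 w')%:E * \int[dV R n]_u (k1 u * F (u, w'))%:E)%E.
  rewrite -ge0_integralZl ?lee_fin//.
  - apply/measurable_EFinP; apply: measurable_funM; first exact: measurable_kfactor.
    exact: (measurableT_comp measurable_F (pair2_measurable w')).
  - by move=> u _; rewrite lee_fin mulr_ge0.
apply: (@le_trans _ _ ((2 `^ c2 * rho w `^ (- a2) * rho w' `^ al2)%:E *
   ((C `^ q1^-1 * rho z `^ (- a1))%:E * J w' `^ p1^-1))%E).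
  apply: lee_pmul; rewrite ?lee_fin ?outer_factor_le//.
  - by apply: integral_ge0 => u _; rewrite lee_fin mulr_ge0.
  - exact: hoelder_inner.
rewrite le_eqVlt; apply/orP; left; apply/eqP.
rewrite muleA -EFinM [in RHS](muleC (J w' `^ _)%E) muleA -EFinM; congr (_%:E * _)%E.
by ring.
Qed.

End fixed_function.

(** Only the modulus is estimated and the phase [th] need only be measurable, so one argument serves
    both kernels. With [q1] conjugate to [p1], [t = (b1 - al1/p1) q1] and [s = c1 q1], the condition
    [t > -1] amounts to [al1 + 1 < p1 (b1 + 1)], and the formula for [c1] gives [n+1+t-s = -a1 q1],
    so that [s > n+1+t] amounts to [a1 > 0]. *)
Lemma bounded_polar_kernel (K : C2 -> C2 -> R[i]) (th : C2 -> C2 -> R) :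
  0 < a1 -> 0 <= a2 -> al1 + 1 < p1 * (b1 + 1) -> al2 <= b2 ->
  c1 = n%:R + 1 + a1 + b1 - (n%:R + 1 + al1) / p1 -> c2 = a2 + b2 - al2 ->
  (forall zw q, K zw q = polar (kmod b1 b2 c1 c2 zw q) (th zw q)) ->
  (forall zw, measurable_fun [set: C2] (th zw)) ->
  bounded_to_Linfty n p1 1 al1 al2 (pref n a1 a2) K.
Proof.
move=> a1_gt0 a2_ge0 b1_gt b2_ge c1E c2E KE mth.
pose q1 : R := p1 / (p1 - 1).
have p0 : 0 < p1 by exact: lt_trans p1_gt1.
have pm1 : 0 < p1 - 1 by rewrite subr_gt0.
have q10 : 0 < q1 by rewrite divr_gt0.
have q1E : q1 / p1 = q1 - 1 by rewrite /q1; field; rewrite !gt_eqF.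
pose t := (b1 - al1 / p1) * q1.
have tE : t = b1 * q1 - al1 * (q1 - 1) by rewrite /t -q1E; ring.
have t1 : -1 < t.
  have h : (t + 1) * (p1 - 1) = p1 * (b1 + 1) - (al1 + 1).
    by rewrite tE /q1; field; rewrite gt_eqF.
  have : 0 < (t + 1) * (p1 - 1) by rewrite h subr_gt0.
  by rewrite pmulr_lgt0//; lra.
have sE : n%:R + 1 + t - c1 * q1 = - (a1 * q1).
  have -> : c1 * q1 = (n%:R + 1 + a1 + b1) * q1 - (n%:R + 1 + al1) * (q1 - 1).
    by rewrite c1E -q1E; ring.
  by rewrite tE; ring.
have ts : n%:R + 1 + t < c1 * q1.
  by rewrite -subr_lt0 sE oppr_lt0 mulr_gt0.
have [C C0 hC] := integral_rho2_le n0 t1 ts.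
pose D := C `^ q1^-1 * 2 `^ c2.
have D0 : 0 <= D by rewrite mulr_ge0 ?powR_ge0.
(* The 2 pays for bounding the real and imaginary parts of the integral separately. *)
exists (2 * D) => f [mfr [mfi ffin]].
have cK zw q : cabs (K zw q * f q) = kmod b1 b2 c1 c2 zw q * cabs (f q).
  by rewrite cabsM KE cabs_polar// kmod_ge0.
have bnd zw : TT zw ->
    (\int[@dV2 R n]_(q in TT) (cabs (K zw q * f q))%:E <=
     (D * (rho zw.1 `^ (- a1) * rho zw.2 `^ (- a2)))%:E * mixnorm p1 1 al1 al2 f)%E.
  case: zw => z w [/= Tz Tw].
  under eq_integral do rewrite cK.
  apply: integral_kmod_le => //.
  by rewrite -sE; exact: hC.
have m0 : (0 <= mixnorm p1 1 al1 al2 f)%E by exact: poweR_ge0.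
have mfin : mixnorm p1 1 al1 al2 f \is a fin_num by rewrite ge0_fin_numE.
have mKr zw : measurable_fun TT (fun q => complex.Re (K zw q)).
  rewrite (_ : (fun q => _) = (fun q => kmod b1 b2 c1 c2 zw q * cos (th zw q))).
    apply: measurable_funTS; apply: measurable_funM; first exact: measurable_kmod.
    apply: measurableT_comp => //.
    by apply: continuous_measurable_fun; exact: continuous_cos.
  by apply/funext => q; rewrite KE.
have mKi zw : measurable_fun TT (fun q => complex.Im (K zw q)).
  rewrite (_ : (fun q => _) = (fun q => - (kmod b1 b2 c1 c2 zw q * sin (th zw q)))).
    apply: measurable_funTS; apply: measurableT_comp => //.
    apply: measurable_funM; first exact: measurable_kmod.
    apply: measurableT_comp => //.
    by apply: continuous_measurable_fun; exact: continuous_sin.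
  by apply/funext => q; rewrite KE.
have mr zw : measurable_fun TT (fun q => complex.Re (K zw q * f q)).
  rewrite (_ : (fun q => _) = (fun q => complex.Re (K zw q) * complex.Re (f q) -
      complex.Im (K zw q) * complex.Im (f q))).
    by apply: measurable_funB; apply: measurable_funM.
  by apply/funext => q; case: (K zw q) => ? ?; case: (f q).
have mi zw : measurable_fun TT (fun q => complex.Im (K zw q * f q)).
  rewrite (_ : (fun q => _) = (fun q => complex.Re (K zw q) * complex.Im (f q) +
      complex.Im (K zw q) * complex.Re (f q))).
    by apply: measurable_funD; apply: measurable_funM.
  by apply/funext => q; case: (K zw q) => ? ?; case: (f q).
have part (g : C2 -> R) zw : TT zw -> measurable_fun TT g ->
    (forall q, `|g q| <= cabs (K zw q * f q)) ->
    (\int[@dV2 R n]_(q in TT) `|(g q)%:E| <=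
     (D * (rho zw.1 `^ (- a1) * rho zw.2 `^ (- a2)) *
       fine (mixnorm p1 1 al1 al2 f))%:E)%E.
  move=> Tzw mg hg; rewrite EFinM fineK//; apply: le_trans (bnd _ Tzw).
  apply: ge0_le_integral => //.
  - by apply: measurableT_comp => //; exact/measurable_EFinP.
  - by apply/measurable_EFinP; apply: measurable_cabs; [exact: mr|exact: mi].
  - by move=> q _; rewrite /= lee_fin.
have ic zw : TT zw -> iconv K f zw.
  move=> Tzw; split; apply/integrableP; split; try exact/measurable_EFinP.
  - apply: le_lt_trans (part _ _ Tzw (mr zw) _) _; last exact: ltry.
    by move=> q; exact: Re_le_cabs.
  - apply: le_lt_trans (part _ _ Tzw (mi zw) _) _; last exact: ltry.
    by move=> q; exact: Im_le_cabs.
split; first by apply: aeW => zw; exact: ic.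
apply: aeW => zw Tzw.
have rpart (g : C2 -> R) : measurable_fun TT g ->
    (forall q, `|g q| <= cabs (K zw q * f q)) ->
    `|Rintegral (@dV2 R n) TT g| <= D * (rho zw.1 `^ (- a1) * rho zw.2 `^ (- a2)) *
       fine (mixnorm p1 1 al1 al2 f).
  move=> mg hg; have h := part g zw Tzw mg hg.
  have mgE : measurable_fun TT (EFin \o g) by exact/measurable_EFinP.
  have ig : (@dV2 R n).-integrable TT (EFin \o g).
    by apply/integrableP; split => //; apply: le_lt_trans h _; exact: ltry.
  rewrite -lee_fin; apply: le_trans h; rewrite /Rintegral.
  have -> : (`|fine (\int[@dV2 R n]_(x in TT) (g x)%:E)%E|%:E =
      `| \int[@dV2 R n]_(x in TT) (g x)%:E |)%E.
    by rewrite -fine_abse ?fineK ?abse_fin_num//; exact: integrable_fin_num ig.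
  exact: le_abse_integral.
rewrite /iop cabsM /pref cabs_real; last by rewrite mulr_ge0 ?powR_ge0.
have hr := rpart _ (mr zw) (fun q => Re_le_cabs _).
have hi := rpart _ (mi zw) (fun q => Im_le_cabs _).
set I := Complex _ _.
have hI : cabs I <= 2 * (D * (rho zw.1 `^ (- a1) * rho zw.2 `^ (- a2)) *
       fine (mixnorm p1 1 al1 al2 f)).
  apply: (le_trans (cabs_le _)); rewrite /I /= mulr_natl mulr2n.
  exact: lerD hr hi.
case: Tzw => Tz Tw.
have rz : 0 < rho zw.1 by move: Tz; rewrite TBE.
have rw : 0 < rho zw.2 by move: Tw; rewrite TBE.
apply: (le_trans (ler_wpM2l _ hI)); first by rewrite mulr_ge0 ?powR_ge0.
have canc (x a : R) : 0 < x -> x `^ a * x `^ (- a) = 1.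
  by move=> x0; rewrite powRN mulfV// gt_eqF// powR_gt0.
rewrite le_eqVlt; apply/orP; left; apply/eqP.
set N := fine _.
have -> : rho zw.1 `^ a1 * rho zw.2 `^ a2 *
  (2 * (D * (rho zw.1 `^ (- a1) * rho zw.2 `^ (- a2)) * N)) =
  (rho zw.1 `^ a1 * rho zw.1 `^ (- a1)) * (rho zw.2 `^ a2 * rho zw.2 `^ (- a2)) *
  (2 * D * N) by ring.
by rewrite !canc// !mul1r.
Qed.

End sufficiency.

(** * Parabolic boxes *)

(** For [c < 0] the power swaps the two bounds; [|c|] in the exponent of [D] covers both signs,
    since the signs of the exponents are not known in the necessity part. *)
Lemma powR_comparable (R : realType) (D x y c : R) : 1 <= D -> 0 < y ->
  y / D <= x <= D * y ->
  D `^ (- `|c|) * y `^ c <= x `^ c <= D `^ `|c| * y `^ c.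
Proof.
move=> D1 y0 /andP[h1 h2].
have D0 : 0 < D by exact: lt_le_trans D1.
have x0 : 0 < x by apply: lt_le_trans h1; rewrite divr_gt0.
have pos (a : R) : 0 <= a -> D `^ (- a) * y `^ a <= x `^ a <= D `^ a * y `^ a.
  move=> a0; apply/andP; split.
  - have -> : D `^ (- a) * y `^ a = (y / D) `^ a.
      by rewrite powRM ?invr_ge0 ?(ltW y0) ?(ltW D0)// mulrC -powR_inv1 ?(ltW D0)// -powRrM mulN1r.
    by rewrite ge0_ler_powR// nnegrE ?(ltW x0)// divr_ge0 ?(ltW y0) ?(ltW D0).
  - rewrite -powRM ?(ltW y0) ?(ltW D0)//.
    by rewrite ge0_ler_powR// nnegrE ?(ltW x0)// mulr_ge0 ?(ltW y0) ?(ltW D0).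
case: (leP 0 c) => c0; first by rewrite ger0_norm//; exact: pos.
rewrite ltr0_norm//.
have Nc : 0 <= - c by rewrite oppr_ge0 ltW.
have -> : x `^ c = x `^ (- - c) by rewrite opprK.
have -> : y `^ c = y `^ (- - c) by rewrite opprK.
have /andP[p1 p2] := pos _ Nc.
rewrite [x `^ (- - c)]powRN [y `^ (- - c)]powRN [D `^ (- - c)]powRN.
have Dp : 0 < D `^ (- c) by exact: powR_gt0.
have xp : 0 < x `^ (- c) by exact: powR_gt0.
have yp : 0 < y `^ (- c) by exact: powR_gt0.
apply/andP; split.
- by rewrite -invfM lef_pV2 ?posrE ?mulr_gt0.
- rewrite [D `^ (- - c)]powRN in p1.
  rewrite -[D `^ (- c)]invrK -invfM lef_pV2 ?posrE ?mulr_gt0 ?invr_gt0//.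
Qed.

Section test_sets.
Variables (R : realType) (n : nat) (kap : R).
Hypotheses (n0 : (0 < n)%N) (kap0 : 0 < kap) (kap1 : kap <= 1).
Implicit Types (s l r : R) (z u : Cn R n).

(** The interval for [rho] is half-open, so that boxes whose parameters [l] differ by a factor 2 are
    disjoint. *)
Let side s l (i : nat) : set R :=
  if i == (2 * n.-1).+1 then `[l ^+ 2, 4 * l ^+ 2[%classic
  else if i == (2 * n.-1)%N then `[- (kap * s ^+ 2), kap * s ^+ 2]%classic
  else `[- (kap * s), kap * s]%classic.

Let sig (i : nat) u : R :=
  if i == (2 * n.-1).+1 then \sum_(j < n.-1) yc u j ^+ 2 else 0.

Definition tbox s l : set (Cn R n) :=
  \bigcap_(i in [set i | (i < 2 * n)%N]) [set u | side s l i (coord u i - sig i u)].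

Let measurable_sig i : measurable_fun [set: Cn R n] (sig i).
Proof.
rewrite /sig; case: (i == _.+1); first exact: measurable_sum_sqr_yc.
exact: measurable_cst.
Qed.

Let measurable_side s l i : measurable (side s l i).
Proof.
by rewrite /side; case: (i == _.+1); [|case: (i == _)]; exact: measurable_itv.
Qed.

Lemma measurable_tbox s l : measurable (tbox s l).
Proof.
apply: bigcap_measurable => [|i _]; first by exists 0%N => /=; rewrite muln_gt0.
have mf : measurable_fun [set: Cn R n] (fun u => coord u i - sig i u).
  by apply: measurable_funB; [exact: measurable_coord|exact: measurable_sig].
by rewrite -[X in measurable X]setTI; apply: mf.
Qed.

Let nE : (2 * n = (2 * n.-1).+2)%N.
Proof. by rewrite -[in LHS](prednK n0) mulnS. Qed.

Lemma tboxP s l u : tbox s l u ->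
  [/\ forall j : 'I_n.-1, `|xc u j| <= kap * s,
      forall j : 'I_n.-1, `|yc u j| <= kap * s,
      `|xc u n.-1| <= kap * s ^+ 2 &
      l ^+ 2 <= rho u < 4 * l ^+ 2].
Proof.
move=> h.
have h' i : (i < (2 * n.-1).+2)%N -> side s l i (coord u i - sig i u).
  by move=> i2; apply: h; rewrite /= nE.
have small i : (i < 2 * n.-1)%N -> `|coord u i| <= kap * s.
  move=> i2; have := h' i (ltn_trans i2 (leqW (leqnn _))).
  rewrite /side /sig (ltn_eqF (ltnW i2 : (i < (2 * n.-1).+1)%N)) (ltn_eqF i2).
  by rewrite /= in_itv /= subr0 ler_norml.
split.
- by move=> j; apply: small; rewrite ltn_pmul2l.
- move=> j; apply: small.
  by have := ltn_ord j; rewrite -(leq_pmul2l (m := 2)) // mulnS addn1.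
- have := h' (2 * n.-1)%N (leqW (leqnn _)).
  by rewrite /side /sig (ltn_eqF (leqnn _)) eqxx /= in_itv /= subr0 ler_norml.
- have := h' (2 * n.-1).+1 (leqnn _).
  by rewrite /side /sig eqxx /= in_itv /= /rho /yc addn1.
Qed.

Lemma tbox_TB s l u : 0 < l -> tbox s l u -> TB u.
Proof.
move=> l0 /tboxP[_ _ _ /andP[h _]]; rewrite TBE.
by apply: lt_le_trans h; rewrite exprn_gt0.
Qed.

(** The sides have lengths [2 kap s] (for [2(n-1)] coordinates), [2 kap s^2] and [3 l^2]; this is
    their product without the powers of [s] and [l]. *)
Definition tbox_const : R := (2 * kap) ^+ (2 * n.-1) * (2 * kap) * 3.

Lemma tbox_const_gt0 : 0 < tbox_const.
Proof. by rewrite /tbox_const !mulr_gt0// exprn_gt0// mulr_gt0. Qed.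

Lemma dV_tbox s l : 0 < s -> 0 < l ->
  dV R n (tbox s l) = (tbox_const * ((s ^+ 2) ^+ n * l ^+ 2))%:E.
Proof.
move=> s0 l0.
rewrite -(setIT (tbox s l)) -integral_indic//; last exact: measurable_tbox.
have -> : (\int[dV R n]_u (\1_(tbox s l) u)%:E =
   \int[dV R n]_u (\prod_(0 <= i < 2 * n)
      (\1_(side s l i) (coord u i - sig i u))%:E))%E.
  apply: eq_integral => u _; rewrite prodEFin; congr (_%:E); rewrite indicE.
  case: (boolP (u \in tbox s l)) => [|/negP]; rewrite inE => hu.
    rewrite big_nat big1// => i i2; rewrite indicE mem_set//.
    by apply: hu; case/andP: i2.
  have [i [i2 hi]] : exists i, (i < 2 * n)%N /\ ~ side s l i (coord u i - sig i u).
    by apply: contrapT => hn; apply: hu => i i2; apply: contrapT => hi; apply: hn; exists i.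
  rewrite (bigD1_seq i) ?mem_index_iota ?iota_uniq//=.
  by rewrite indicE memNset// mul0r.
have /= -> := @integral_shear_prod R (2 * n) (fun i x => (\1_(side s l i) x)%:E) sig.
- have lm (a b : bool) (x y : R) : x <= y ->
      (\int[lebesgue_measure]_v (\1_[set` Interval (BSide a x) (BSide b y)] v)%:E = (y - x)%:E)%E.
    move=> xy; rewrite integral_indic// setIT.
    transitivity (lebesgue_measure [set` Interval (BSide a x) (BSide b y)]); first by [].
    rewrite lebesgue_measure_itv /= lte_fin.
    case: ltP => // yx; have -> : y = x by apply/eqP; rewrite eq_le xy yx.
    by rewrite subrr.
  have splitE (F : nat -> \bar R) : (\prod_(0 <= i < 2 * n) F i =
      \prod_(0 <= i < 2 * n.-1) F i * F (2 * n.-1)%N * F (2 * n.-1).+1)%E.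
    by rewrite nE big_nat_recr//= big_nat_recr.
  rewrite splitE.
  have ks0 : 0 < kap * s by rewrite mulr_gt0.
  have ks20 : 0 < kap * s ^+ 2 by rewrite mulr_gt0// exprn_gt0.
  have l20 : 0 < l ^+ 2 by rewrite exprn_gt0.
  have -> : (\prod_(0 <= i < 2 * n.-1) \int[lebesgue_measure]_v (\1_(side s l i) v)%:E =
     \prod_(0 <= i < 2 * n.-1) (2 * kap * s)%:E)%E.
    rewrite big_nat [RHS]big_nat; apply: eq_bigr => i /andP[_ i2].
    rewrite /side (ltn_eqF (ltnW i2 : (i < (2 * n.-1).+1)%N)) (ltn_eqF i2).
    by rewrite lm; [congr (_%:E); ring|lra].
  rewrite /side (ltn_eqF (leqnn _)) !eqxx !lm; [|lra|lra].
  rewrite prodEFin -!EFinM prodr_const_nat subn0; congr (_%:E).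
  have -> : (s ^+ 2) ^+ n = s ^+ (2 * n.-1) * s ^+ 2.
    by rewrite -exprM -exprD nE -addn2.
  by rewrite /tbox_const exprMn; ring.
- by move=> i; apply/measurable_EFinP; apply: measurable_indic.
- by move=> i x; rewrite lee_fin.
- exact: measurable_sig.
- move=> i u v h; rewrite /sig; case: eqP => [iE|//].
  apply: eq_bigr => j _; rewrite /yc h// iE.
  by have := ltn_ord j; rewrite -(leq_pmul2l (m := 2)) // mulnS addn1 ltnS => /ltnW.
Qed.

(** In units of [max(r,l)^2], the real part of [rho2] is at most [4 + 2n] and its imaginary part at
    most [1 + 2n] in modulus. Their sum also exceeds the range factor 4 of [rho] on a box. *)
Let D : R := 5 + 4 * n%:R.

Lemma rho_tbox s l u : 0 < l -> tbox s l u ->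
  l ^+ 2 / D <= rho u <= D * l ^+ 2.
Proof.
move=> l0 /tboxP[_ _ _ /andP[h1 h2]].
have l20 : 0 < l ^+ 2 by rewrite exprn_gt0.
have D1 : 5 <= D by rewrite /D lerDl mulr_ge0.
apply/andP; split.
- apply: le_trans h1; rewrite ler_pdivrMr; last by lra.
  by rewrite ler_pMr//; lra.
- by apply: (le_trans (ltW h2)); rewrite ler_pM2r//; lra.
Qed.

(** The real part is at least [(rho z + rho u)/2], hence at least half of [max(r,l)^2] whatever
    [kap] is, while every term of the imaginary part carries a factor [kap]. The slope is therefore
    controlled by [kap] alone, and [2 + 4n] is [1 + 2n] divided by that half. The condition
    [s <= max r l] keeps the box of [u] at the same scale. *)
Lemma rho2_tbox s l r z u : 0 < s -> 0 < l -> 0 < r -> s <= Num.max r l ->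
  tbox r r z -> tbox s l u ->
  Num.max r l ^+ 2 / D <= cabs (rho2 z u) <= D * Num.max r l ^+ 2 /\
  `|complex.Im (rho2 z u)| <= kap * (2 + 4 * n%:R) * complex.Re (rho2 z u).
Proof.
move=> s0 l0 r0; set M := Num.max r l => sM bz bu.
have [xz yz xnz /andP[rz1 rz2]] := tboxP bz.
have [xu yu xnu /andP[ru1 ru2]] := tboxP bu.
have rM : r <= M by rewrite le_max lexx.
have lM : l <= M by rewrite le_max lexx orbT.
have M0 : 0 < M by exact: lt_le_trans rM.
have sqM (x : R) : 0 < x -> x <= M -> x ^+ 2 <= M ^+ 2.
  by move=> x0 xM; rewrite ler_sqr // nnegrE ltW.
have M2 : 0 < M ^+ 2 by rewrite exprn_gt0.
have n1 : n.-1%:R <= n%:R :> R by rewrite ler_nat leq_pred.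
have n00 : 0 <= n.-1%:R :> R by [].
have kM x y : `|x| <= kap * s -> `|y| <= kap * r -> `|x| + `|y| <= 2 * (kap * M).
  move=> hx hy; have : kap * s <= kap * M by rewrite ler_pM2l.
  have : kap * r <= kap * M by rewrite ler_pM2l.
  by lra.
have ReL : M ^+ 2 / 2 <= complex.Re (rho2 z u).
  apply: le_trans (Re_rho2_ge z u); rewrite ler_pM2r ?invr_gt0//.
  rewrite /M; case: (leP r l) => rl.
  - by have := exprn_gt0 2 r0; lra.
  - by have := exprn_gt0 2 l0; lra.
(* One of the two factors [kap] is given up through [kap <= 1]; the remaining one makes the
   imaginary part small. *)
have kM2 : (2 * (kap * M)) ^+ 2 <= 4 * kap * M ^+ 2.
  have -> : (2 * (kap * M)) ^+ 2 = 4 * kap * M ^+ 2 * kap by ring.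
  have h : 0 <= 4 * kap * M ^+ 2 by have := mulr_gt0 kap0 M2; lra.
  exact: ler_piMr.
have kM4 : (2 * (kap * M)) ^+ 2 <= 4 * M ^+ 2.
  apply: (le_trans kM2).
  have : kap * M ^+ 2 <= M ^+ 2 by rewrite ler_piMl// ltW.
  lra.
have ReU : complex.Re (rho2 z u) <= (4 + 2 * n%:R) * M ^+ 2.
  rewrite Re_rho2.
  have h1 : (rho z + rho u) / 2 <= 4 * M ^+ 2.
    by have := sqM _ r0 rM; have := sqM _ l0 lM; lra.
  have h2 : \sum_(j < n.-1) ((xc z j - xc u j) ^+ 2 + (yc z j - yc u j) ^+ 2) <=
      \sum_(j < n.-1) (8 * M ^+ 2).
    apply: ler_sum => j _.
    have sq (x y : R) : `|x| <= kap * s -> `|y| <= kap * r -> (y - x) ^+ 2 <= 4 * M ^+ 2.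
      move=> hx hy; apply: le_trans kM4.
      rewrite -real_normK ?num_real// ler_sqr ?nnegrE ?mulr_ge0 ?(ltW kap0) ?(ltW M0)//.
      by apply: (le_trans (ler_normB _ _)); rewrite addrC; exact: kM.
    by have := sq _ _ (xu j) (xz j); have := sq _ _ (yu j) (yz j); lra.
  rewrite sumr_const card_ord -[X in _ <= X]mulr_natl in h2.
  have : n.-1%:R * (8 * M ^+ 2) <= n%:R * (8 * M ^+ 2).
    by rewrite ler_pM2r// mulr_gt0.
  by lra.
have ImU : `|complex.Im (rho2 z u)| <= kap * (1 + 2 * n%:R) * M ^+ 2.
  rewrite Im_rho2 normrM [X in _ * X]ger0_norm ?invr_ge0// ler_pdivrMr//.
  have h2 : `|\sum_(j < n.-1) (xc z j - xc u j) * (yc z j + yc u j)| <=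
      \sum_(j < n.-1) (4 * kap * M ^+ 2).
    apply: (le_trans (ler_norm_sum _ _ _)); apply: ler_sum => j _.
    rewrite normrM; apply: le_trans kM2; rewrite expr2; apply: ler_pM => //.
    - by apply: (le_trans (ler_normB _ _)); rewrite addrC; exact: kM.
    - by apply: (le_trans (ler_normD _ _)); rewrite addrC; exact: kM.
  rewrite sumr_const card_ord -[X in _ <= X]mulr_natl in h2.
  have h3 : n.-1%:R * (4 * kap * M ^+ 2) <= n%:R * (4 * kap * M ^+ 2).
    by rewrite ler_pM2r// !mulr_gt0.
  have h4 : kap * s ^+ 2 <= kap * M ^+ 2 by rewrite ler_pM2l// sqM.
  have h5 : kap * r ^+ 2 <= kap * M ^+ 2 by rewrite ler_pM2l// sqM.
  apply: (le_trans (ler_normB _ _)).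
  have := ler_normB (xc z n.-1) (\sum_(j < n.-1) (xc z j - xc u j) * (yc z j + yc u j)).
  by lra.
have Re0 : 0 < complex.Re (rho2 z u) by apply: lt_le_trans ReL; rewrite divr_gt0.
split; first (apply/andP; split).
- apply: (le_trans _ (le_trans (ler_norm _) (Re_le_cabs _))).
  apply: le_trans ReL; rewrite ler_pM2l// lef_pV2 ?posrE//; rewrite /D.
  - by have := ler0n R n; lra.
  - by have := ler0n R n; lra.
- apply: (le_trans (cabs_le _)); rewrite (gtr0_norm Re0).
  have : kap * (1 + 2 * n%:R) * M ^+ 2 <= (1 + 2 * n%:R) * M ^+ 2.
    by rewrite ler_pM2r// ler_piMl// addr_ge0// mulr_ge0.
  by rewrite /D; lra.
- apply: (le_trans ImU).
  have -> : kap * (2 + 4 * n%:R) * complex.Re (rho2 z u) =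
    (kap * (1 + 2 * n%:R)) * (2 * complex.Re (rho2 z u)) by ring.
  rewrite ler_wpM2l//; last by lra.
  by rewrite mulr_ge0 ?(ltW kap0)// addr_ge0// mulr_ge0.
Qed.

End test_sets.

Arguments tbox {R} n kap s l u : rename.

Lemma dV2_tbox (R : realType) n (kap s l s' l' : R) : (0 < n)%N -> 0 < kap ->
  0 < s -> 0 < l -> 0 < s' -> 0 < l' ->
  @dV2 R n (tbox n kap s l `*` tbox n kap s' l') =
  (tbox_const n kap * ((s ^+ 2) ^+ n * l ^+ 2) *
   (tbox_const n kap * ((s' ^+ 2) ^+ n * l' ^+ 2)))%:E.
Proof.
move=> n0 kap0 s0 l0 s'0 l'0.
have -> : @dV2 R n (tbox n kap s l `*` tbox n kap s' l') =
    (dV R n (tbox n kap s l) * dV R n (tbox n kap s' l'))%E.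
  by apply: product_measure1E; exact: measurable_tbox.
by rewrite !dV_tbox// -EFinM.
Qed.

(** * Test functions *)

Lemma integral_sum_indic d (T : measurableType d) (R : realType)
    (mu : {measure set T -> \bar R}) (D : set T) N (A : nat -> set T)
    (c v : nat -> R) :
  measurable D -> (forall k, measurable (A k)) -> (forall k, A k `<=` D) ->
  (forall k, 0 <= c k) -> (forall k, mu (A k) = (v k)%:E) ->
  (\int[mu]_(x in D) (\sum_(k < N) c k * \1_(A k) x)%:E =
   (\sum_(k < N) c k * v k)%:E)%E.
Proof.
move=> mD mA AD c0 muA.
under eq_integral do rewrite -sumEFin.
rewrite ge0_integral_sum//; first last.
- by move=> k x _; rewrite lee_fin mulr_ge0.
- move=> k; apply/measurable_EFinP; apply: measurable_funM.
    exact: measurable_cst.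
  exact: measurable_indic.
rewrite -sumEFin; apply: eq_bigr => k _.
under eq_integral do rewrite EFinM.
rewrite ge0_integralZl//; first last.
- by rewrite lee_fin.
- by apply/measurable_EFinP; exact: measurable_indic.
by rewrite integral_indic// (setIidl (AD k)) muA.
Qed.

(** Boundedness gives statements almost everywhere, whereas the tests need an actual point in a
    given box: a set of positive measure is not covered by two negligible exceptional sets. *)
Lemma ae_witness d (T : measurableType d) (R : realType)
    (mu : {measure set T -> \bar R}) (D A : set T) (P Q : T -> Prop) :
  {ae mu, forall x, D x -> P x} -> {ae mu, forall x, D x -> Q x} ->
  measurable A -> A `<=` D -> (0 < mu A)%E -> exists x, [/\ A x, P x & Q x].
Proof.
move=> aeP aeQ mA AD A0; apply: contrapT => nex.
have : mu.-negligible A.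
  apply: negligibleS (negligibleU aeP aeQ) => x Ax.
  case: (pselect (P x)) => Px.
  - right => /(_ (AD _ Ax)) Qx; apply: nex; by exists x.
  - by left => /(_ (AD _ Ax)).
by move=> /(negligibleP _ mA) muA; rewrite muA ltxx in A0.
Qed.

(** At each point at most one term is nonzero. With the [p1]-th power as [h], this makes the [p1]-th
    power of the norm additive over boxes. *)
Lemma sum_indic_disjoint (T : Type) (R : realType) N (A : nat -> set T)
    (c : nat -> R) (h : R -> R) x : h 0 = 0 ->
  (forall i j, i != j -> A i `&` A j = set0) ->
  h (\sum_(k < N) c k * \1_(A k) x) = \sum_(k < N) h (c k) * \1_(A k) x.
Proof.
move=> h0 dis.
case: (pselect (exists k : 'I_N, A k x)) => [[k Ak]|nk].
- have other (i : 'I_N) : i != k -> \1_(A i) x = 0 :> R.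
    move=> ik; rewrite indicE memNset// => Ai.
    by have := dis i k ik; rewrite -subset0 => /(_ x); apply.
  rewrite (bigD1 k)//= [in RHS](bigD1 k)//= !big1 ?addr0.
  + by rewrite indicE mem_set// !mulr1.
  + by move=> i ik; rewrite other// mulr0.
  + by move=> i ik; rewrite other// mulr0.
- have none (i : 'I_N) : \1_(A i) x = 0 :> R.
    by rewrite indicE memNset// => Ai; apply: nk; exists i.
  by rewrite !big1// => i _; rewrite none mulr0.
Qed.

Section test_functions.
Variables (R : realType) (n : nat) (kap p1 al1 al2 : R).
Hypotheses (n0 : (0 < n)%N) (kap0 : 0 < kap) (p1_gt1 : 1 < p1).
Variables (N : nat) (lam s l : nat -> R) (t : R).
Hypotheses (lam0 : forall k, 0 <= lam k) (s0 : forall k, 0 < s k)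
  (l0 : forall k, 0 < l k) (t0 : 0 < t).
Local Notation C2 := (Cn R n * Cn R n)%type.
Local Notation TT := (@TB R n `*` @TB R n).

Let B k := tbox n kap (s k) (l k).
Let E := tbox n kap t t.
Let c0 := tbox_const n kap.
Let D : R := 5 + 4 * n%:R.

Hypothesis disj : forall i j, i != j -> B i `&` B j = set0.

(** Several boxes occur in the first variable only, where strict inequalities are to be proved; the
    weak ones and the equalities already follow from one box in each variable. *)
Definition testf (q : C2) : R :=
  (\sum_(k < N) lam k * \1_(B k) q.1) * \1_E q.2.

Let mB k : measurable (B k). Proof. exact: measurable_tbox. Qed.
Let mE : measurable E. Proof. exact: measurable_tbox. Qed.
Let BT k : B k `<=` @TB R n. Proof. by move=> u; exact: tbox_TB. Qed.
Let ET : E `<=` @TB R n. Proof. by move=> u; exact: tbox_TB. Qed.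
Let D1 : 1 <= D. Proof. by rewrite /D; have := ler0n R n; lra. Qed.
Let p1_gt0 : 0 < p1. Proof. exact: lt_trans p1_gt1. Qed.

Lemma testf_ge0 q : 0 <= testf q.
Proof. by rewrite mulr_ge0// sumr_ge0// => k _; rewrite mulr_ge0. Qed.

Let g (u : Cn R n) : R := \sum_(k < N) lam k * \1_(B k) u.

Let measurable_g : measurable_fun [set: Cn R n] g.
Proof.
apply: measurable_sum => k; apply: measurable_funM; first exact: measurable_cst.
exact: measurable_indic.
Qed.

Lemma measurable_testf : measurable_fun [set: C2] testf.
Proof.
apply: measurable_funM.
- exact: (measurableT_comp measurable_g measurable_fst).
- exact: (measurableT_comp (measurable_indic mE) measurable_snd).
Qed.

Let V k := (s k ^+ 2) ^+ n * l k ^+ 2.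
Let W := (t ^+ 2) ^+ n * t ^+ 2.

Let Xe := (\int[dV R n]_(u in @TB R n) (g u `^ p1 * rho u `^ al1)%:E)%E.

Let Xe_le : (Xe <= (D `^ `|al1| * c0 *
   \sum_(k < N) lam k `^ p1 * ((l k ^+ 2) `^ al1 * V k))%:E)%E.
Proof.
have -> : D `^ `|al1| * c0 *
   \sum_(k < N) lam k `^ p1 * ((l k ^+ 2) `^ al1 * V k) =
   \sum_(k < N) (lam k `^ p1 * (D `^ `|al1| * (l k ^+ 2) `^ al1)) * (c0 * V k).
  by rewrite mulr_sumr; apply: eq_bigr => k _; ring.
have mTB := @measurable_TB R n.
have c_ge0 k : 0 <= lam k `^ p1 * (D `^ `|al1| * (l k ^+ 2) `^ al1).
  by rewrite !mulr_ge0 ?powR_ge0.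
rewrite -(@integral_sum_indic _ _ _ (dV R n) _ N B _ (fun k => c0 * V k) mTB mB BT c_ge0); last first.
  by move=> k; exact: dV_tbox.
apply: ge0_le_integral => //.
- by move=> u _; rewrite lee_fin mulr_ge0 ?powR_ge0.
- apply: measurable_funTS; apply/measurable_EFinP; apply: measurable_funM.
    exact: (measurableT_comp (measurable_powR _)).
  apply: (measurableT_comp (measurable_powR _)); exact: measurable_rho.
- apply: measurable_funTS; apply/measurable_EFinP; apply: measurable_sum => k.
  by apply: measurable_funM; [exact: measurable_cst|exact: measurable_indic].
move=> u Tu; rewrite lee_fin.
rewrite /g (@sum_indic_disjoint _ R N B lam (fun x => x `^ p1) u)//; last first.
  by rewrite powR0// gt_eqF.
rewrite mulr_suml; apply: ler_sum => k _.
rewrite indicE; case: (boolP (u \in B k)) => [|_]; last by rewrite !mulr0 mul0r.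
rewrite inE !mulr1 => Bu; apply: ler_wpM2l; first exact: powR_ge0.
have l20 : 0 < l k ^+ 2 by rewrite exprn_gt0.
by have /andP[] := powR_comparable al1 D1 l20 (rho_tbox n0 (l0 k) Bu).
Qed.

Let Y_le : (\int[dV R n]_(w in @TB R n) (\1_E w * rho w `^ al2)%:E <=
   (D `^ `|al2| * (t ^+ 2) `^ al2 * (c0 * W))%:E)%E.
Proof.
have mTB := @measurable_TB R n.
have t20 : 0 < t ^+ 2 by rewrite exprn_gt0.
pose cc := D `^ `|al2| * (t ^+ 2) `^ al2.
have cc0 : 0 <= cc by rewrite mulr_ge0 ?powR_ge0.
have -> : (cc * (c0 * W))%:E = (\int[dV R n]_(w in @TB R n) (cc * \1_E w)%:E)%E.
  under eq_integral do rewrite EFinM.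
  rewrite ge0_integralZl//; last first.
    by apply/measurable_EFinP; exact: measurable_indic.
  by rewrite integral_indic// (setIidl ET) EFinM; congr (_ * _)%E; apply/esym; exact: dV_tbox.
apply: ge0_le_integral => //.
- by move=> w _; rewrite lee_fin mulr_ge0 ?powR_ge0.
- apply: measurable_funTS; apply/measurable_EFinP; apply: measurable_funM.
    exact: measurable_indic.
  apply: (measurableT_comp (measurable_powR _)); exact: measurable_rho.
- apply: measurable_funTS; apply/measurable_EFinP; apply: measurable_funM.
    exact: measurable_cst.
  exact: measurable_indic.
move=> w Tw; rewrite lee_fin indicE; case: (boolP (w \in E)) => [|_].
  rewrite inE mul1r mulr1 => Ew.
  by have /andP[] := powR_comparable al2 D1 t20 (rho_tbox n0 t0 Ew).
by rewrite mul0r mulr0.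
Qed.

Lemma mixnorm_testf_le : (mixnorm p1 1 al1 al2 (fun q => (testf q)%:C%C) <=
  ((D `^ `|al1| * c0 * \sum_(k < N) lam k `^ p1 * ((l k ^+ 2) `^ al1 * V k)) `^ p1^-1 *
   (D `^ `|al2| * (t ^+ 2) `^ al2 * (c0 * W)))%:E)%E.
Proof.
have mTB := @measurable_TB R n.
rewrite /mixnorm invr1 poweRe1; last first.
  by apply: integral_ge0 => w _; rewrite mule_ge0 ?poweR_ge0// lee_fin powR_ge0.
have Xe0 : (0 <= Xe)%E.
  by apply: integral_ge0 => u _; rewrite lee_fin mulr_ge0 ?powR_ge0.
have -> : (\int[dV R n]_(w in @TB R n)
    ((\int[dV R n]_(z in @TB R n)
       (cabs ((testf (z, w))%:C%C) `^ p1 * rho z `^ al1)%:E) `^ (1 / p1) *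
     (rho w `^ al2)%:E) =
  \int[dV R n]_(w in @TB R n) (Xe `^ p1^-1 * (\1_E w * rho w `^ al2)%:E))%E.
  apply: eq_integral => w _; rewrite div1r indicE.
  have testE z : cabs ((testf (z, w))%:C%C) = g z * (w \in E)%:R.
    by rewrite cabs_real ?testf_ge0.
  case: (boolP (w \in E)) testE => [_|_] testE.
    rewrite mul1r.
    suff -> : (\int[dV R n]_(z in @TB R n)
       (cabs ((testf (z, w))%:C%C) `^ p1 * rho z `^ al1)%:E = Xe)%E by [].
    by apply: eq_integral => z _; rewrite testE mulr1.
  rewrite mul0r mule0 (_ : (\int[dV R n]_(z in @TB R n) _)%E = 0%E).
    by rewrite poweR0r ?mul0e// invr_eq0 gt_eqF.
  by apply: integral0_eq => z _; rewrite testE mulr0 powR0 ?mul0r// gt_eqF.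
rewrite ge0_integralZl//; first last.
- exact: poweR_ge0.
- by move=> w _; rewrite lee_fin mulr_ge0 ?powR_ge0.
- apply: measurable_funTS; apply/measurable_EFinP; apply: measurable_funM.
    exact: measurable_indic.
  apply: (measurableT_comp (measurable_powR _)); exact: measurable_rho.
rewrite EFinM; apply: lee_pmul => //.
- exact: poweR_ge0.
- by apply: integral_ge0 => w _; rewrite lee_fin mulr_ge0 ?powR_ge0.
rewrite -poweR_EFin; apply: gt0_ler_poweR => //.
- by rewrite invr_ge0 ltW.
- by rewrite in_itv /= leey andbT.
- by rewrite in_itv /= leey andbT (le_trans Xe0).
Qed.

Lemma inLmixed_testf : inLmixed p1 1 al1 al2 (fun q => (testf q)%:C%C).
Proof.
split; first by apply: measurable_funTS; exact: measurable_testf.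
split; first exact: measurable_cst.
by apply: le_lt_trans mixnorm_testf_le _; exact: ltry.
Qed.

End test_functions.

(** * Lower bounds for the operators on test functions *)

Section necessity.
Variables (R : realType) (n : nat) (kap p1 a1 a2 b1 b2 c1 c2 al1 al2 : R).
Hypotheses (n0 : (0 < n)%N) (kap0 : 0 < kap) (kap1 : kap <= 1) (p1_gt1 : 1 < p1).
Local Notation C2 := (Cn R n * Cn R n)%type.
Local Notation TT := (@TB R n `*` @TB R n).
Variables (K : C2 -> C2 -> R[i]) (th : C2 -> C2 -> R).
Hypothesis KE : forall zw q, K zw q = polar (kmod b1 b2 c1 c2 zw q) (th zw q).
Hypothesis cos_th : forall zw q,
  `|complex.Im (rho2 zw.1 q.1)| <=
    kap * (2 + 4 * n%:R) * complex.Re (rho2 zw.1 q.1) ->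
  `|complex.Im (rho2 zw.2 q.2)| <=
    kap * (2 + 4 * n%:R) * complex.Re (rho2 zw.2 q.2) ->
  2^-1 <= cos (th zw q).
Hypothesis bK : bounded_to_Linfty n p1 1 al1 al2 (pref n a1 a2) K.

Let D : R := 5 + 4 * n%:R.
Let c0 : R := tbox_const n kap.
Let D1 : 1 <= D. Proof. by rewrite /D; have := ler0n R n; lra. Qed.
Let D0 : 0 < D. Proof. exact: lt_le_trans D1. Qed.
Let c00 : 0 < c0. Proof. exact: tbox_const_gt0. Qed.

Let kfactor_ge (b c s l r : R) (z u : Cn R n) :
  0 < s -> 0 < l -> 0 < r -> s <= Num.max r l ->
  tbox n kap r r z -> tbox n kap s l u ->
  D `^ (- `|b|) * D `^ (- `|c|) *
    ((l ^+ 2) `^ b * (Num.max r l ^+ 2) `^ (- c)) <=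
  rho u `^ b * cabs (rho2 z u) `^ (- c).
Proof.
move=> s0 l0 r0 sM bz bu.
have l20 : 0 < l ^+ 2 by rewrite exprn_gt0.
have M20 : 0 < Num.max r l ^+ 2 by rewrite exprn_gt0// lt_max r0.
have /andP[h1 _] := powR_comparable b D1 l20 (rho_tbox n0 l0 bu).
have [hr _] := rho2_tbox n0 kap0 kap1 s0 l0 r0 sM bz bu.
have /andP[h2 _] := powR_comparable (- c) D1 M20 hr.
by rewrite mulrACA; apply: ler_pM; rewrite ?mulr_ge0 ?powR_ge0//; rewrite normrN in h2.
Qed.

(** Collects the losses of all lower bounds: prefactor, both kernel factors, the 1/2 from [cos_th],
    and the volume constant of the boxes in [u]. The weighted volume of the box in eta is left out,
    since it occurs on both sides and cancels. *)
Let eps : R := D `^ (- `|a1|) * D `^ (- `|a2|) *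
  (D `^ (- `|b1|) * D `^ (- `|c1|) * (D `^ (- `|b2|) * D `^ (- `|c2|))) / 2 * c0.

Let eps0 : 0 < eps.
Proof.
by apply: mulr_gt0 c00; apply: divr_gt0 => //; rewrite !mulr_gt0 ?powR_gt0.
Qed.

(** The image of [testf] is evaluated at a point of [tbox r r] times [tbox q q] and compared with
    [mixnorm_testf_le]. The separation of the [l k] makes the boxes disjoint, which is what keeps
    [C] independent of [N]. Cancelling the weight of the box in eta turns the exponent [b2] of [t]
    into [b2 - al2]. *)
Lemma test_inequality : exists2 C : R, 0 <= C &
  forall (r q t : R) (N : nat) (lam s l : nat -> R),
  0 < r -> 0 < q -> 0 < t -> (forall k, 0 <= lam k) -> (forall k, 0 < s k) ->
  (forall k, 0 < l k) -> (forall k, s k <= Num.max r (l k)) ->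
  (forall i j, i != j -> 4 * l i ^+ 2 <= l j ^+ 2 \/ 4 * l j ^+ 2 <= l i ^+ 2) ->
  (r ^+ 2) `^ a1 * (q ^+ 2) `^ a2 *
    ((t ^+ 2) `^ (b2 - al2) * (Num.max q t ^+ 2) `^ (- c2)) *
    \sum_(k < N) lam k * ((l k ^+ 2) `^ b1 * (Num.max r (l k) ^+ 2) `^ (- c1) *
      ((s k ^+ 2) ^+ n * l k ^+ 2)) <=
  C * (\sum_(k < N) lam k `^ p1 *
      ((l k ^+ 2) `^ al1 * ((s k ^+ 2) ^+ n * l k ^+ 2))) `^ p1^-1.
Proof.
have [Cb hCb] := bK.
exists (`|Cb| * (D `^ `|al1| * c0) `^ p1^-1 * D `^ `|al2| / eps).
  by rewrite divr_ge0 ?(ltW eps0)// !mulr_ge0 ?powR_ge0.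
move=> r q t N lam s l r0 q0 t0 lam0 s0 l0 sM sep.
pose B k := tbox n kap (s k) (l k).
pose E := tbox n kap t t.
have disj i j : i != j -> B i `&` B j = set0.
  move=> ij; rewrite -subset0 => u [/(tboxP n0)[_ _ _ /andP[h1 h2]]].
  move=> /(tboxP n0)[_ _ _ /andP[h3 h4]].
  by case: (sep i j ij) => h; lra.
have disj' : forall i j, i != j ->
  tbox n kap (s i) (l i) `&` tbox n kap (s j) (l j) = set0 by exact: disj.
pose f := @testf R n kap N lam s l t.
have [hconv hbd] := hCb _ (inLmixed_testf al1 al2 n0 kap0 p1_gt1 N lam0 s0 l0 t0 disj').
have mixle := mixnorm_testf_le al1 al2 n0 kap0 p1_gt1 N lam0 s0 l0 t0 disj'.
rewrite -/f -/D -/c0 in hconv hbd mixle.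
set V := fun k => (s k ^+ 2) ^+ n * l k ^+ 2.
set W := (t ^+ 2) ^+ n * t ^+ 2.
have t20 : 0 < t ^+ 2 by rewrite exprn_gt0.
have W0 : 0 < W by rewrite mulr_gt0// exprn_gt0.
have V0 k : 0 <= V k by rewrite mulr_ge0// ?exprn_ge0// ?exprn_ge0// ltW.
set S := \sum_(k < N) lam k `^ p1 * _ in mixle *.
have S0 : 0 <= S.
  rewrite sumr_ge0// => k _.
  exact: mulr_ge0 (powR_ge0 _ _) (mulr_ge0 (powR_ge0 _ _) (V0 k)).
have mP : measurable (tbox n kap r r `*` tbox n kap q q).
  by apply: measurableX; exact: measurable_tbox.
have PT : tbox n kap r r `*` tbox n kap q q `<=` TT.
  by move=> [z w] [/= hz hw]; split; [exact: tbox_TB hz|exact: tbox_TB hw].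
have P0 : (0 < @dV2 R n (tbox n kap r r `*` tbox n kap q q))%E.
  rewrite dV2_tbox// lte_fin.
  have dp (x : R) : 0 < x -> 0 < c0 * ((x ^+ 2) ^+ n * x ^+ 2).
    by move=> x0; apply: mulr_gt0 => //; rewrite mulr_gt0 ?exprn_gt0.
  exact: mulr_gt0 (dp _ r0) (dp _ q0).
have [zw [Pzw conv bd]] := ae_witness hconv hbd mP PT P0.
have [bz bw] := Pzw.
have TTm : measurable TT by apply: measurableX; exact: measurable_TB.
pose m k := D `^ (- `|b1|) * D `^ (- `|c1|) *
    ((l k ^+ 2) `^ b1 * (Num.max r (l k) ^+ 2) `^ (- c1)) *
  (D `^ (- `|b2|) * D `^ (- `|c2|) *
    ((t ^+ 2) `^ b2 * (Num.max q t ^+ 2) `^ (- c2))).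
have m0 k : 0 <= m k by rewrite /m !mulr_ge0 ?powR_ge0.
have cc0 k : 0 <= lam k * (m k / 2) by rewrite mulr_ge0// divr_ge0.
(* Off the product boxes the integrand is 0; on the k-th one the cosine is at least 1/2, so the real
   part is at least [lam k * (m k / 2)] and no cancellation occurs. *)
have lower : \sum_(k < N) (lam k * (m k / 2)) * (c0 * V k * (c0 * W)) <=
    Rintegral (@dV2 R n) TT (fun q => complex.Re (K zw q * (f q)%:C%C)).
  have [ir _] := conv.
  rewrite -lee_fin /Rintegral fineK; last exact: integrable_fin_num ir.
  rewrite -(@integral_sum_indic _ _ _ (@dV2 R n) TT N (fun k => B k `*` E) _
     (fun k => c0 * V k * (c0 * W)) TTm _ _ cc0); first last.
  - by move=> k; exact: dV2_tbox.
  - by move=> k [u e] [/= hu he]; split; [exact: tbox_TB hu|exact: tbox_TB he].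
  - by move=> k; apply: measurableX; exact: measurable_tbox.
  apply: ge0_le_integral => //.
  - by move=> x _; rewrite lee_fin sumr_ge0// => k _; rewrite mulr_ge0.
  - apply: measurable_funTS; apply/measurable_EFinP; apply: measurable_sum => k.
    apply: measurable_funM; first exact: measurable_cst.
    by apply: measurable_indic; apply: measurableX; exact: measurable_tbox.
  - exact: measurable_int ir.
  move=> [u e] [Tu Te]; rewrite lee_fin.
  have -> : complex.Re (K zw (u, e) * (f (u, e))%:C%C) =
      kmod b1 b2 c1 c2 zw (u, e) * cos (th zw (u, e)) * f (u, e).
    by rewrite KE /polar /=; ring.
  rewrite /f /testf /= mulr_suml mulr_sumr; apply: ler_sum => k _.
  rewrite !indicE in_setX /=.
  case: (boolP (u \in tbox n kap (s k) (l k))) => [|_]; last first.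
    by rewrite !mulr0 !mul0r mulr0.
  case: (boolP (e \in tbox n kap t t)) => [|_]; last by rewrite !mulr0.
  rewrite !inE => he hu; rewrite !mulr1 [leRHS]mulrC.
  rewrite ler_wpM2l//; apply: ler_pM; rewrite ?invr_ge0//.
  - have tM : t <= Num.max q t by rewrite le_max lexx orbT.
    rewrite /m /kmod /=; apply: ler_pM; rewrite ?mulr_ge0 ?powR_ge0//.
    + exact: kfactor_ge (sM k) bz hu.
    + exact: kfactor_ge tM bw he.
  - apply: cos_th => /=.
    + by have [] := rho2_tbox n0 kap0 kap1 (s0 k) (l0 k) r0 (sM k) bz hu.
    + have tM : t <= Num.max q t by rewrite le_max lexx orbT.
      by have [] := rho2_tbox n0 kap0 kap1 t0 t0 q0 tM bw he.
have prefge : D `^ (- `|a1|) * D `^ (- `|a2|) * ((r ^+ 2) `^ a1 * (q ^+ 2) `^ a2) <=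
    rho zw.1 `^ a1 * rho zw.2 `^ a2.
  have r20 : 0 < r ^+ 2 by rewrite exprn_gt0.
  have q20 : 0 < q ^+ 2 by rewrite exprn_gt0.
  have /andP[h1 _] := powR_comparable a1 D1 r20 (rho_tbox n0 r0 bz).
  have /andP[h2 _] := powR_comparable a2 D1 q20 (rho_tbox n0 q0 bw).
  by rewrite mulrACA; apply: ler_pM; rewrite ?mulr_ge0 ?powR_ge0.
set Q := (X in X * \sum_(k < N) _ <= _).
set SL := (X in Q * X <= _).
have chain : eps * (Q * SL) * (c0 * W) * (t ^+ 2) `^ al2 <=
   `|Cb| * ((D `^ `|al1| * c0 * S) `^ p1^-1 *
     (D `^ `|al2| * (t ^+ 2) `^ al2 * (c0 * W))).
  apply: (@le_trans _ _ (D `^ (- `|a1|) * D `^ (- `|a2|) *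
      ((r ^+ 2) `^ a1 * (q ^+ 2) `^ a2) *
     \sum_(k < N) (lam k * (m k / 2)) * (c0 * V k * (c0 * W)))).
    rewrite le_eqVlt; apply/orP; left; apply/eqP.
    have -> : \sum_(k < N) lam k * (m k / 2) * (c0 * V k * (c0 * W)) =
      (D `^ (- `|b1|) * D `^ (- `|c1|) * (D `^ (- `|b2|) * D `^ (- `|c2|))) / 2 * c0 *
      ((t ^+ 2) `^ b2 * (Num.max q t ^+ 2) `^ (- c2)) * (c0 * W) * SL.
      by rewrite /SL mulr_sumr; apply: eq_bigr => k _; rewrite /m /V; ring.
    have -> : (t ^+ 2) `^ b2 = (t ^+ 2) `^ (b2 - al2) * (t ^+ 2) `^ al2.
      by rewrite -powRD ?subrK//; apply/implyP => _; rewrite gt_eqF.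
    by rewrite /eps /Q; ring.
  apply: (@le_trans _ _ (cabs (iop (pref n a1 a2) K (fun q => (f q)%:C%C) zw))).
    rewrite /iop cabsM /pref cabs_real; last by rewrite mulr_ge0 ?powR_ge0.
    apply: ler_pM => //.
    - by rewrite !mulr_ge0 ?powR_ge0.
    - apply: sumr_ge0 => k _; rewrite mulr_ge0//.
      exact: mulr_ge0 (mulr_ge0 (ltW c00) (V0 k)) (mulr_ge0 (ltW c00) (ltW W0)).
    apply: (le_trans lower).
    apply: le_trans (Re_le_cabs _) => /=; exact: ler_norm.
  apply: (le_trans bd).
  have mn0 : (0 <= mixnorm p1 1 al1 al2 (fun q => (f q)%:C%C))%E by exact: poweR_ge0.
  apply: (@le_trans _ _ (`|Cb| * fine (mixnorm p1 1 al1 al2 (fun q => (f q)%:C%C)))).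
    by rewrite ler_wpM2r ?ler_norm// fine_ge0.
  rewrite ler_wpM2l// -lee_fin fineK// ge0_fin_numE//.
  by apply: le_lt_trans mixle _; exact: ltry.
have U0 : 0 < (c0 * W) * (t ^+ 2) `^ al2.
  by apply: mulr_gt0; [exact: mulr_gt0|exact: powR_gt0].
have DC0 : 0 <= D `^ `|al1| * c0 := mulr_ge0 (powR_ge0 _ _) (ltW c00).
rewrite (powRM _ DC0 S0) in chain.
rewrite [leRHS]mulrAC ler_pdivlMr// -(ler_pM2r U0).
apply: le_trans (le_trans _ chain) _; rewrite le_eqVlt; apply/orP; left; apply/eqP; ring.
Qed.

End necessity.

(** * Exponents *)

Lemma powR_bounded_near0 (R : realType) (e C : R) :
  (forall x, 0 < x -> x <= 1 -> x `^ e <= C) -> 0 <= e.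
Proof.
move=> h; rewrite leNgt; apply/negP => e0.
(* As [e < 0] and [y >= 1], the point [y^(1/e)] lies in []0, 1]], and its [e]-th power [y] exceeds
   [C]. *)
pose y := `|C| + 1.
have y1 : 1 <= y by rewrite /y lerDr.
have y0 : 0 < y by exact: lt_le_trans y1.
have := h (y `^ e^-1) (powR_gt0 _ y0).
have -> : y `^ e^-1 <= 1.
  by rewrite -[leRHS](powRr0 y) ler_powR// invr_le0 ltW.
rewrite -powRrM mulVf ?lt_eqF// powRr1 ?(ltW y0)// /y => /(_ isT).
by have := ler_norm C; lra.
Qed.

Lemma powR_bounded (R : realType) (e C : R) :
  (forall x, 0 < x -> x `^ e <= C) -> e = 0.
Proof.
move=> h; apply/eqP; rewrite eq_le -oppr_ge0; apply/andP; split.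
- apply: (@powR_bounded_near0 _ _ C) => x x0 _.
  have -> : x `^ (- e) = x^-1 `^ e by rewrite -powR_inv1 ?ltW// -powRrM mulN1r.
  by apply: h; rewrite invr_gt0.
- by apply: (@powR_bounded_near0 _ _ C) => x x0 _; exact: h.
Qed.

(** Dividing by [N^(1/p)] would bound the positive power [N^(1-1/p)] over all [N]. *)
Lemma nat_le_root_false (R : realType) (p C : R) : 1 < p ->
  ~ (forall N : nat, N%:R <= C * N%:R `^ p^-1).
Proof.
move=> p1 h.
have p0 : 0 < p by exact: lt_trans p1.
pose e := 1 - p^-1.
have e0 : 0 < e by rewrite subr_gt0 invf_lt1.
pose y := (`|C| + 1) `^ e^-1.
have C10 : 0 < `|C| + 1 by rewrite ltr_wpDl.
pose N := (Num.truncn y).+1.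
have yN : y <= N%:R by rewrite ltW// truncnS_gt.
have N0 : 0 < N%:R :> R by [].
have : N%:R `^ e <= C.
  have := h N.
  have NE : N%:R = N%:R `^ e * N%:R `^ p^-1 :> R.
    rewrite -powRD; last by apply/implyP => _; rewrite gt_eqF.
    by rewrite subrK powRr1.
  by rewrite [leLHS]NE ler_pM2r ?powR_gt0.
have : y `^ e <= N%:R `^ e by rewrite ge0_ler_powR ?(ltW e0)// nnegrE ?powR_ge0.
rewrite /y -powRrM mulVf ?gt_eqF// powRr1 ?(ltW C10)//.
by have := ler_norm C; lra.
Qed.

Section exponents.
Variables (R : realType) (n : nat) (p1 a1 a2 b1 b2 c1 c2 al1 al2 C : R).
Hypotheses (p1_gt1 : 1 < p1) (C0 : 0 <= C).
Hypothesis H : forall (r q t : R) (N : nat) (lam s l : nat -> R),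
  0 < r -> 0 < q -> 0 < t -> (forall k, 0 <= lam k) -> (forall k, 0 < s k) ->
  (forall k, 0 < l k) -> (forall k, s k <= Num.max r (l k)) ->
  (forall i j, i != j -> 4 * l i ^+ 2 <= l j ^+ 2 \/ 4 * l j ^+ 2 <= l i ^+ 2) ->
  (r ^+ 2) `^ a1 * (q ^+ 2) `^ a2 *
    ((t ^+ 2) `^ (b2 - al2) * (Num.max q t ^+ 2) `^ (- c2)) *
    \sum_(k < N) lam k * ((l k ^+ 2) `^ b1 * (Num.max r (l k) ^+ 2) `^ (- c1) *
      ((s k ^+ 2) ^+ n * l k ^+ 2)) <=
  C * (\sum_(k < N) lam k `^ p1 *
      ((l k ^+ 2) `^ al1 * ((s k ^+ 2) ^+ n * l k ^+ 2))) `^ p1^-1.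

Let p1_gt0 : 0 < p1. Proof. exact: lt_trans p1_gt1. Qed.

(** Ratio 2 in [l] is ratio 4 in [rho], exactly the extent of one box, so consecutive boxes are
    adjacent. *)
Let dyadic (x : R) (k : nat) : R := x * 2 ^+ k.

Let dyadic_gt0 x k : 0 < x -> 0 < dyadic x k.
Proof. by move=> x0; rewrite mulr_gt0// exprn_gt0. Qed.

Let dyadic_lt x i j : (i < j)%N -> 4 * dyadic x i ^+ 2 <= dyadic x j ^+ 2.
Proof.
move=> ij; rewrite /dyadic.
have -> : 4 * (x * 2 ^+ i) ^+ 2 = (x * 2 ^+ i.+1) ^+ 2 by rewrite [2 ^+ i.+1]exprS; ring.
rewrite !exprMn ler_wpM2l ?sqr_ge0// ler_sqr ?nnegrE ?exprn_ge0//.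
by rewrite ler_eXn2l// ltr1n.
Qed.

Let dyadic_sep x i j : i != j ->
  4 * dyadic x i ^+ 2 <= dyadic x j ^+ 2 \/ 4 * dyadic x j ^+ 2 <= dyadic x i ^+ 2.
Proof.
by rewrite neq_ltn => /orP[] ij; [left|right]; exact: dyadic_lt.
Qed.

Let dyadic_max r x k : dyadic x k <= Num.max r (dyadic x k).
Proof. by rewrite le_max lexx orbT. Qed.

Let nz (x : R) (c : bool) : 0 < x -> c ==> (x != 0).
Proof. by move=> x0; apply/implyP => _; rewrite gt_eqF. Qed.

Let sqr_pow (x e : R) : 0 <= x -> (x ^+ 2) `^ e = x `^ (2 * e).
Proof. by move=> x0; rewrite powRrM powR_mulrn. Qed.

(** One unit box in [u] and [r = 1] reduce every factor of the first variable to 1. *)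
Let outer_test q t : 0 < q -> 0 < t ->
  (q ^+ 2) `^ a2 * ((t ^+ 2) `^ (b2 - al2) * (Num.max q t ^+ 2) `^ (- c2)) <= C.
Proof.
move=> q0 t0.
have := @H 1 q t 1%N (fun=> 1) (dyadic 1) (dyadic 1) ltr01 q0 t0 (fun=> ler01)
  (fun k => dyadic_gt0 k ltr01) (fun k => dyadic_gt0 k ltr01)
  (dyadic_max 1 1) (@dyadic_sep 1).
by rewrite !big_ord1 /dyadic expr0 !mulr1 maxxx !expr1n !powR1 !mul1r !mulr1 powR1 mulr1.
Qed.

(** With [q = t = 1] and one box with [s = l = r], every factor is a power of [r^2]; the exponent is
    the difference of those of the two sides. *)
Let inner_test r : 0 < r ->
  (r ^+ 2) `^ (a1 + b1 - c1 + n%:R + 1 - (n%:R + 1 + al1) / p1) <= C.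
Proof.
move=> r0.
have r20 : 0 < r ^+ 2 by rewrite exprn_gt0.
have := @H r 1 1 1%N (fun=> 1) (dyadic r) (dyadic r) r0 ltr01 ltr01 (fun=> ler01)
  (fun k => dyadic_gt0 k r0) (fun k => dyadic_gt0 k r0)
  (dyadic_max r r) (@dyadic_sep r).
rewrite !big_ord1 /dyadic expr0 !mulr1 !maxxx !expr1n !powR1 !mul1r !mulr1.
have -> : (r ^+ 2) ^+ n * r ^+ 2 = (r ^+ 2) `^ (n%:R + 1).
  by rewrite powRD ?nz// powR_mulrn ?(ltW r20)// powRr1 ?(ltW r20).
rewrite -!powRD ?nz// -powRrM.
rewrite -ler_pdivrMr ?powR_gt0// -powRN -powRD ?nz//.
apply: le_trans; rewrite le_eqVlt; apply/orP; left; apply/eqP; congr (_ `^ _).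
by ring.
Qed.

(** On the diagonal [q = t = x] the test is a single power of [x], bounded both near 0 and near
    infinity. *)
Let c2E : c2 = a2 + b2 - al2.
Proof.
suff : 2 * (a2 + b2 - al2 - c2) = 0 by lra.
apply: (@powR_bounded _ _ C) => x x0; have x20 : 0 < x ^+ 2 by rewrite exprn_gt0.
rewrite -sqr_pow ?(ltW x0)//; apply: le_trans (outer_test x0 x0).
rewrite maxxx -!powRD ?nz// le_eqVlt; apply/orP; left; apply/eqP; congr (_ `^ _).
by ring.
Qed.

(** For [q = x <= 1 = t] the maximum is 1, and only the power of [q] survives. *)
Let a2_ge0 : 0 <= a2.
Proof.
suff : 0 <= 2 * a2 by lra.
apply: (@powR_bounded_near0 _ _ C) => x x0 x1.
rewrite -sqr_pow ?(ltW x0)//; apply: le_trans (outer_test x0 ltr01).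
by rewrite (max_idPr x1) expr1n !powR1 !mulr1.
Qed.

(** Here the roles are exchanged: [q = 1] and [t = x <= 1]. *)
Let b2_ge : al2 <= b2.
Proof.
suff : 0 <= 2 * (b2 - al2) by lra.
apply: (@powR_bounded_near0 _ _ C) => x x0 x1.
rewrite -sqr_pow ?(ltW x0)//; apply: le_trans (outer_test ltr01 x0).
by rewrite (max_idPl x1) expr1n !powR1 mulr1 mul1r.
Qed.

Let c1E : c1 = n%:R + 1 + a1 + b1 - (n%:R + 1 + al1) / p1.
Proof.
suff : 2 * (a1 + b1 - c1 + n%:R + 1 - (n%:R + 1 + al1) / p1) = 0 by lra.
apply: (@powR_bounded _ _ C) => x x0.
by rewrite -sqr_pow ?(ltW x0)//; exact: inner_test.
Qed.

(* If [a1 <= 0], the boxes at heights [4 ^ k] weighted to have equal norms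
   contribute equally, and [N <= C N ^ (1 / p1)]. *)
Let a1_gt0 : 0 < a1.
Proof.
rewrite ltNge; apply/negP => a1_le0.
apply: (@nat_le_root_false R p1 C p1_gt1) => N.
pose l := dyadic 1.
have l0 k : 0 < l k by exact: dyadic_gt0.
have l20 k : 0 < l k ^+ 2 by rewrite exprn_gt0.
have l1 k : 1 <= l k by rewrite /l /dyadic mul1r exprn_ege1// ler1n.
(* The weighted volume of the k-th box is [(l^2)^(n+1+al1)], so each term on the right becomes 1. On
   the left, [c1E] leaves [(l^2)^(-a1)], which is at least 1 since [l >= 1] and [a1 <= 0]. *)
pose lam k := (l k ^+ 2) `^ (- ((n%:R + 1 + al1) / p1)).
have vol k : (l k ^+ 2) ^+ n * l k ^+ 2 = (l k ^+ 2) `^ (n%:R + 1).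
  by rewrite powRD ?nz// powR_mulrn ?(ltW (l20 k))// powRr1 ?(ltW (l20 k)).
have := @H 1 1 1 N lam l l ltr01 ltr01 ltr01 (fun k => powR_ge0 _ _) l0 l0.
rewrite maxxx expr1n !powR1 !mul1r => h.
apply: le_trans (le_trans (h _ (@dyadic_sep 1)) _).
- rewrite -[leLHS]mulr1 mulr_natl -[in leLHS](card_ord N) -sumr_const.
  apply: ler_sum => k _; rewrite (max_idPr (l1 k)) vol -!powRD ?nz//.
  have -> : - ((n%:R + 1 + al1) / p1) + (b1 - c1 + (n%:R + 1)) = - a1.
    by rewrite c1E; ring.
  rewrite -[leLHS](powRr0 (l k ^+ 2)) ler_powR ?oppr_ge0//.
  by rewrite -[leLHS](expr1n R 2) ler_sqr ?nnegrE ?ler01 ?(ltW (l0 k)).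
- by move=> k; rewrite le_max lexx orbT.
rewrite ler_wpM2l// (_ : \sum_(k < N) _ = N%:R)//.
rewrite -[RHS]mulr1 mulr_natl -[in RHS](card_ord N) -sumr_const; apply: eq_bigr => k _.
rewrite vol /lam -powRrM -!powRD ?nz//.
have -> : - ((n%:R + 1 + al1) / p1) * p1 + (al1 + (n%:R + 1)) = 0.
  by rewrite mulNr mulfVK ?gt_eqF//; ring.
by rewrite powRr0.
Qed.

(* The same argument with the layers [rho ~ 4 ^ (- k)] of a fixed box. *)
Let b1_gt : al1 + 1 < p1 * (b1 + 1).
Proof.
rewrite ltNge; apply/negP => b1_le.
apply: (@nat_le_root_false R p1 C p1_gt1) => N.
pose l k := (dyadic 1 k)^-1.
have l0 k : 0 < l k by rewrite invr_gt0 dyadic_gt0.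
have l20 k : 0 < l k ^+ 2 by rewrite exprn_gt0.
have l1 k : l k <= 1 by rewrite invf_le1 ?dyadic_gt0// /dyadic mul1r exprn_ege1// ler1n.
have l21 k : l k ^+ 2 <= 1 by rewrite exprn_ile1// ltW.
have lsep i j : i != j -> 4 * l i ^+ 2 <= l j ^+ 2 \/ 4 * l j ^+ 2 <= l i ^+ 2.
  have aux i' j' : 4 * dyadic 1 i' ^+ 2 <= dyadic 1 j' ^+ 2 -> 4 * l j' ^+ 2 <= l i' ^+ 2.
    rewrite /l !exprVn => h.
    rewrite ler_pdivrMr ?exprn_gt0 ?dyadic_gt0// mulrC ler_pdivlMr ?exprn_gt0 ?dyadic_gt0//.
  by move=> /(dyadic_sep 1)[h|h]; [right|left]; exact: aux.
(* With [s = 1] the weighted volume is only [(l^2)^(al1+1)], and this weight normalises it to 1. The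
   terms on the left are [(l^2)^(b1+1-(al1+1)/p1)] with [l <= 1] and exponent at most 0, hence at
   least 1. *)
pose lam k := (l k ^+ 2) `^ (- ((al1 + 1) / p1)).
have := @H 1 1 1 N lam (fun=> 1) l ltr01 ltr01 ltr01 (fun k => powR_ge0 _ _)
  (fun=> ltr01) l0.
rewrite maxxx !expr1n !powR1 !mul1r => h.
apply: le_trans (le_trans (h _ lsep) _).
- rewrite -[leLHS]mulr1 mulr_natl -[in leLHS](card_ord N) -sumr_const.
  apply: ler_sum => k _; rewrite (max_idPl (l1 k)) !expr1n powR1 mulr1 mul1r.
  rewrite -[X in _ * (_ * X)](powRr1 (ltW (l20 k))) -!powRD ?nz//.
  rewrite -[leLHS](powRr0 (l k ^+ 2)) ger_powR ?l20 ?l21//.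
  have : b1 + 1 <= (al1 + 1) / p1 by rewrite ler_pdivlMr// mulrC.
  by lra.
- by move=> k; rewrite le_max lexx.
rewrite ler_wpM2l// (_ : \sum_(k < N) _ = N%:R)//.
rewrite -[RHS]mulr1 mulr_natl -[in RHS](card_ord N) -sumr_const; apply: eq_bigr => k _.
rewrite ?expr1n ?mul1r -[X in _ * (_ * X)](powRr1 (ltW (l20 k))) /lam -powRrM -!powRD ?nz//.
have -> : - ((al1 + 1) / p1) * p1 + (al1 + 1) = 0.
  by rewrite mulNr mulfVK ?gt_eqF//; ring.
by rewrite powRr0.
Qed.

Lemma exponents_of_tests :
  0 < a1 /\ 0 <= a2 /\ al1 + 1 < p1 * (b1 + 1) /\ al2 <= b2 /\
  c1 = n%:R + 1 + a1 + b1 - (n%:R + 1 + al1) / p1 /\ c2 = a2 + b2 - al2.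
Proof. by do 5?split. Qed.

End exponents.

(** The phase is a combination of arguments [atan(Im/Re)], so continuity of [cos] and [atan] at 0
    makes small slopes sufficient, with a threshold independent of the points. *)
Lemma cos_karg_ge (R : realType) n (c1 c2 : R) :
  exists2 e : R, 0 < e & forall zw q : (Cn R n * Cn R n)%type,
  `|complex.Im (rho2 zw.1 q.1)| <= e * complex.Re (rho2 zw.1 q.1) ->
  `|complex.Im (rho2 zw.2 q.2)| <= e * complex.Re (rho2 zw.2 q.2) ->
  2^-1 <= cos (karg c1 c2 zw q).
Proof.
have [e1 e10 he1] : exists2 e : R, 0 < e & forall x, `|x| < e -> 2^-1 <= cos x.
  have /cvgrPdist_lt /(_ 2^-1) := @continuous_cos R 0.
  rewrite invr_gt0 ltr0n cos0 => /(_ isT) /nbhs_ballP[e /= e0 he].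
  exists e => // x xe; have := he x; rewrite /ball /= sub0r normrN => /(_ xe).
  by rewrite ltr_norml => /andP[_]; lra.
(* The added 1 makes [b] positive and the final bound strict. *)
pose b := `|c1| + `|c2| + 1.
have b0 : 0 < b by rewrite ltr_wpDl// addr_ge0.
have [e2 e20 he2] : exists2 e : R, 0 < e & forall x, `|x| < e -> `|atan x| < e1 / b.
  have /cvgrPdist_lt /(_ (e1 / b)) := @continuous_atan R 0.
  rewrite divr_gt0// atan0 => /(_ isT) /nbhs_ballP[e /= e0 he].
  exists e => // x xe; have := he x; rewrite /ball /= sub0r normrN => /(_ xe).
  by rewrite sub0r normrN.
exists (e2 / 2) => [|zw q h1 h2]; first by rewrite divr_gt0.
have slope (w : R[i]) : `|complex.Im w| <= e2 / 2 * complex.Re w ->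
    `|atan (complex.Im w / complex.Re w)| < e1 / b.
  move=> hw; apply: he2.
  have [->|r0] := eqVneq (complex.Re w) 0; first by rewrite invr0 mulr0 normr0.
  have rp : 0 < complex.Re w.
    rewrite lt0r r0 /=; have := le_trans (normr_ge0 _) hw.
    by rewrite pmulr_rge0// divr_gt0.
  rewrite normrM normfV (gtr0_norm rp) ltr_pdivrMr//; apply: (le_lt_trans hw).
  by rewrite ltr_pM2r//; lra.
apply: he1; rewrite /karg; apply: (le_lt_trans (ler_normD _ _)); rewrite !normrM.
have := slope _ h1; have := slope _ h2.
set y := `|atan _| => hy; set x := `|atan _| => hx.
have xb : `|c1| * x <= `|c1| * (e1 / b) by rewrite ler_wpM2l// ltW.
have yb : `|c2| * y <= `|c2| * (e1 / b) by rewrite ler_wpM2l// ltW.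
have : (`|c1| + `|c2|) * (e1 / b) < e1.
  rewrite mulrA ltr_pdivrMr// mulrC ltr_pM2l// /b; lra.
by rewrite mulrDl; lra.
Qed.

Lemma exponents_of_bounded (R : realType) n (p1 a1 a2 b1 b2 c1 c2 al1 al2 : R)
    (K : (Cn R n * Cn R n)%type -> (Cn R n * Cn R n)%type -> R[i])
    (th : (Cn R n * Cn R n)%type -> (Cn R n * Cn R n)%type -> R) (e : R) :
  (0 < n)%N -> 1 < p1 -> 0 < e ->
  (forall zw q, K zw q = polar (kmod b1 b2 c1 c2 zw q) (th zw q)) ->
  (forall zw q,
    `|complex.Im (rho2 zw.1 q.1)| <= e * complex.Re (rho2 zw.1 q.1) ->
    `|complex.Im (rho2 zw.2 q.2)| <= e * complex.Re (rho2 zw.2 q.2) ->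
    2^-1 <= cos (th zw q)) ->
  bounded_to_Linfty n p1 1 al1 al2 (pref n a1 a2) K ->
  0 < a1 /\ 0 <= a2 /\ al1 + 1 < p1 * (b1 + 1) /\ al2 <= b2 /\
  c1 = n%:R + 1 + a1 + b1 - (n%:R + 1 + al1) / p1 /\ c2 = a2 + b2 - al2.
Proof.
move=> n0 p1_gt1 e0 KE hth bK.
have d0 : 0 < 2 + 4 * n%:R :> R by have := ler0n R n; lra.
(* [rho2_tbox] allows slopes up to [kap (2 + 4n)]; this choice brings them below [e]. *)
pose kap := Num.min 1 (e / (2 + 4 * n%:R)).
have kap0 : 0 < kap by rewrite lt_min ltr01 divr_gt0.
have kap1 : kap <= 1 by rewrite ge_min lexx.
have kape : kap * (2 + 4 * n%:R) <= e.
  by rewrite -ler_pdivlMr// ge_min lexx orbT.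
have nearReal (w : R[i]) :
    `|complex.Im w| <= kap * (2 + 4 * n%:R) * complex.Re w ->
    `|complex.Im w| <= e * complex.Re w.
  move=> h; apply: (le_trans h); apply: ler_wpM2r => //.
  by have := le_trans (normr_ge0 _) h; rewrite pmulr_rge0// mulr_gt0.
have cth zw q :
    `|complex.Im (rho2 zw.1 q.1)| <= kap * (2 + 4 * n%:R) * complex.Re (rho2 zw.1 q.1) ->
    `|complex.Im (rho2 zw.2 q.2)| <= kap * (2 + 4 * n%:R) * complex.Re (rho2 zw.2 q.2) ->
    2^-1 <= cos (th zw q).
  by move=> h1 h2; apply: hth; exact: nearReal.
have [C C0 HC] := test_inequality n0 kap0 kap1 p1_gt1 KE cth bK.
exact: exponents_of_tests p1_gt1 C0 HC.
Qed.

Theorem theorem6p8 (R : realType) (n : nat) (p1 a1 a2 b1 b2 c1 c2 al1 al2 : R) :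
  (0 < n)%N -> 1 < p1 -> -1 < al1 -> -1 < al2 ->
  (bounded_to_Linfty n p1 1 al1 al2 (pref n a1 a2) (kerS n b1 b2 c1 c2) <->
   bounded_to_Linfty n p1 1 al1 al2 (pref n a1 a2) (kerT n b1 b2 c1 c2)) /\
  (bounded_to_Linfty n p1 1 al1 al2 (pref n a1 a2) (kerT n b1 b2 c1 c2) <->
   (0 < a1 /\ 0 <= a2 /\ al1 + 1 < p1 * (b1 + 1) /\ al2 <= b2 /\
    c1 = n%:R + 1 + a1 + b1 - (n%:R + 1 + al1) / p1 /\
    c2 = a2 + b2 - al2)).
Proof.
move=> n0 p1_gt1 _ _.
set bS := bounded_to_Linfty _ _ _ _ _ _ (kerS _ _ _ _ _).
set bT := bounded_to_Linfty _ _ _ _ _ _ (kerT _ _ _ _ _).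
set cond := (is_true (0 < a1) /\ _).
have SC : bS -> cond.
  (* The phase of the positive kernel is 0, so any positive slope bound will do, for instance 1. *)
  apply: (@exponents_of_bounded _ _ _ _ _ _ _ _ _ _ _ _ (fun _ _ => 0) 1) => //.
  - by move=> zw q; exact: kerSE.
  - by move=> zw q _ _; rewrite cos0; lra.
have TC : bT -> cond.
  have [e e0 he] := @cos_karg_ge R n c1 c2.
  apply: (@exponents_of_bounded _ _ _ _ _ _ _ _ _ _ _ _ (karg c1 c2) e) => //.
  by move=> zw q; exact: kerTE.
have CS : cond -> bS.
  move=> [h1 [h2 [h3 [h4 [h5 h6]]]]].
  apply: (@bounded_polar_kernel _ _ _ _ _ b1 b2 c1 c2 _ _ n0 p1_gt1 _
    (fun _ _ => 0)) => //.
  by move=> zw q; exact: kerSE.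
have CT : cond -> bT.
  move=> [h1 [h2 [h3 [h4 [h5 h6]]]]].
  apply: (@bounded_polar_kernel _ _ _ _ _ b1 b2 c1 c2 _ _ n0 p1_gt1 _
    (karg c1 c2)) => //.
  - by move=> zw q; exact: kerTE.
  - by move=> zw; exact: measurable_karg.
by split; split => h; [exact: CT (SC h)|exact: CS (TC h)|exact: TC|exact: CT].
Qed.
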